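(* Let $d\ge 1$, let $(\xi(z)\colon z\in\mathbb{Z}^d)$ be independent with $P(\xi(z)>x)=e^{-x}$ for $x\ge 0$, let $u$ be the unique nonnegative solution of the parabolic Anderson model with potential $\xi$ and initial condition $\mathbf 1_{0}$, let $U(t)=\sum_{z\in\mathbb{Z}^d}u(t,z)$ and $L_t=\frac1t\log U(t)$. Then, as $t\to\infty$, $$L_t-d\log t+d\log\log\log t\ \Rightarrow\ X,$$ where $\Rightarrow$ denotes convergence in distribution and $X$ has the Gumbel distribution $$P(X\le x)=\exp\big\{-2^d e^{-x-2d}\big\}\qquad\text{for } x\in\mathbb{R}.$$
   Context: The parabolic Anderson model with time-constant potential $\xi$ is the Cauchy problem $$\partial_t u(t,z)=\Delta u(t,z)+\xi(z)u(t,z)\ \text{ for }(t,z)\in(0,\infty)\times\mathbb{Z}^d,\qquad \lim_{t\downarrow0}u(t,z)=\mathbf 1_{0}(z)\ \text{ for } z\in\mathbb{Z}^d,$$ where $(\Delta f)(z)=\sum_{y\sim z}[f(y)-f(z)]$ is the (unnormalised) discrete Laplacian, the sum being over the $2d$ nearest neighbours of $z$. Its unique nonnegative solution is, almost surely, given by the Feynman-Kac formula $u(t,z)=\mathbb{E}\big[\exp\{\int_0^t\xi(X_s)\,ds\}\mathbf 1\{X_t=z\}\big]$, where $(X_s)_{s\ge0}$ is the continuous-time simple random walk on $\mathbb{Z}^d$ started at the origin with generator $\Delta$, and $\mathbb{E}$ is expectation over the walk only (for fixed $\xi$). *)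

(* Defs.v *)
From HB Require Import structures.
From mathcomp Require Export all_boot all_order all_algebra.
From mathcomp Require Export finmap.
From mathcomp Require Export all_classical all_reals all_analysis.

Set Implicit Arguments.
Unset Strict Implicit.
Unset Printing Implicit Defensive.

Export numFieldNormedType.Exports.

Local Open Scope classical_set_scope.
Local Open Scope ring_scope.

Definition lattice (d : nat) := 'rV[int]_d.

Definition unit_vec (d : nat) (i : 'I_d) : lattice d := delta_mx 0 i.

(* The 2d nearest neighbours of z are z + e_i and z - e_i for i < d. *)
Definition laplacian (R : realType) (d : nat) (f : lattice d -> R)
    (z : lattice d) : R :=
  \sum_(i < d) ((f (z + unit_vec i) - f z) + (f (z - unit_vec i) - f z)).

(* Functions of time are total on R; only their values at times t > 0 are
   constrained. *)
Definition pam_solution (R : realType) (d : nat) (xi : lattice d -> R)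
    (v : R -> lattice d -> R) : Prop :=
  (forall (t : R) (z : lattice d), 0 < t ->
     is_derive t 1 (fun s : R => v s z) (laplacian (v t) z + xi z * v t z)) /\
  (forall z : lattice d, v t z @[t --> 0^'+] --> ((z == 0)%:R : R)).

Definition nonneg_pam_solution (R : realType) (d : nat) (xi : lattice d -> R)
    (v : R -> lattice d -> R) : Prop :=
  pam_solution xi v /\ (forall (t : R) (z : lattice d), 0 < t -> 0 <= v t z).

Definition unique_nonneg_pam_solution (R : realType) (d : nat)
    (xi : lattice d -> R) (v : R -> lattice d -> R) : Prop :=
  nonneg_pam_solution xi v /\
  (forall v' : R -> lattice d -> R, nonneg_pam_solution xi v' ->
     forall (t : R) (z : lattice d), 0 < t -> v' t z = v t z).

Definition total_mass (R : realType) (d : nat) (v : R -> lattice d -> R)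
    (t : R) : \bar R :=
  \esum_(z in [set: lattice d]) (v t z)%:E.

(* Extended-real valued: [lne +oo = +oo], so an infinite total mass is not
   turned into a finite junk value. *)
Definition growth_rate (R : realType) (d : nat) (v : R -> lattice d -> R)
    (t : R) : \bar R :=
  ((t^-1)%:E * lne (total_mass v t))%E.

Definition mutually_independent (disp : measure_display)
    (T : measurableType disp) (R : realType) (P : probability T R)
    (I : choiceType) (X : I -> {RV P >-> R}) : Prop :=
  forall (J : {fset I}) (A : I -> set R), (forall i, measurable (A i)) ->
    P (\bigcap_(i in [set` J]) (X i @^-1` A i)) =
    (\prod_(i <- J) P (X i @^-1` A i))%E.

(* Convergence in distribution, as t -> +oo, of (possibly extended-real valued)
   Y t to a real random variable X that may live on another probability
   space. *)
Definition cvg_in_distribution (R : realType)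
    (disp : measure_display) (T : measurableType disp) (P : probability T R)
    (Y : R -> T -> \bar R)
    (disp' : measure_display) (T' : measurableType disp')
    (Q : probability T' R) (X : {RV Q >-> R}) : Prop :=
  forall x : R, {for x, continuous (cdf X)} ->
    P [set w | (Y t w <= x%:E)%E] @[t --> +oo] --> cdf X x.

(* Main.v *)
Require Import Defs.
From mathcomp Require Import zify ring lra.

(* Removing the constant [-2d] from the diagonal, [e^(2dt) u t z] is the power
   series with nonnegative coefficients [wcoef k z / k!], the minimal solution.
   Lower bound on the total mass: walking to [z] and staying there contributes
   about [exp (t (xi z - 2d) - |z| ln (xi z))], with [|.|] the l1 norm.
   Upper bound: off an event of small probability, the sites where [xi] is close
   to its maximum are far apart, and a sum over concentric balls ("levels") of
   exponentials in time, with spatial profiles that decay by a factor of order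
   [1 / ln t] per step, dominates the coefficients.  Since [ln (xi z)] is close to
   [ln ln t] at the relevant sites, the growth rate is
   [max_z (xi z - |z| ln ln t / t) - 2d] up to a vanishing error, and
   independence gives
   [P(xi z <= h + c |z| for all z) ~ exp (- e^(-h) (2 / c)^d)] for
   [c = ln ln t / t]. *)

Set Implicit Arguments.
Unset Strict Implicit.
Unset Printing Implicit Defensive.
Import Order.TTheory GRing.Theory Num.Theory.

Local Open Scope classical_set_scope.
Local Open Scope ring_scope.

(** * Geometry of the lattice *)

(** The obstacle in the upper bound: the profile must shrink by a factor of order [ln t] per step,
    but at a site near the maximum an inner neighbour larger by that factor would raise the growth
    rate far too much. The profile is therefore made flat around such sites and raised there by a
    constant [C], so that the neighbours add only [2 d / C] to the rate. Sites lower by a fixed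
    fraction of the maximum have room for the whole factor. This needs only that no two high sites
    lie within a bounded distance: at height [3 H / 4], with [H] near [d ln t], a pair has
    probability about [t ^ (- 3 d / 2)], against about [t ^ d] pairs, up to powers of [ln t]. Levels
    are needed because the admissible potential grows with slope [c], so that no single rate serves
    the whole lattice. A level of radius [r] gains [c r t] in the exponent, slightly less than
    [r ln ln t], and pays almost [r ln ln t] for being reached. Comparing Taylor coefficients, which
    have finite support, turns the comparison into an induction and avoids a maximum principle on an
    infinite lattice. *)

Definition norm1 (d : nat) (z : lattice d) : nat := (\sum_(i < d) `|(z 0%R i)|)%N.
Arguments norm1 {d} z%_R.

Lemma norm1_0 d : norm1 (0 : lattice d) = 0%N.
Proof. by rewrite /norm1 big1// => i _; rewrite mxE. Qed.

Lemma norm1N d (z : lattice d) : norm1 (- z) = norm1 z.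
Proof. by apply: eq_bigr => i _; rewrite mxE abszN. Qed.

Lemma norm1D d (y z : lattice d) : (norm1 (y + z) <= norm1 y + norm1 z)%N.
Proof.
have tri (a b : int) : (`|(a + b)%R| <= `|a| + `|b|)%N by lia.
by rewrite -big_split; apply: leq_sum => i _; rewrite mxE; exact: tri.
Qed.

Lemma norm1_eq0 d (z : lattice d) : norm1 z = 0%N -> z = 0.
Proof.
move=> /eqP; rewrite sum_nat_eq0 => /forallP z0; apply/matrixP => i j.
by rewrite ord1 mxE; apply/eqP; have := z0 j; rewrite absz_eq0.
Qed.

Lemma norm1_unit d (i : 'I_d) : norm1 (unit_vec i) = 1%N.
Proof.
rewrite /norm1 (bigD1 i)//= big1 ?addn0 => [|j ji].
  by rewrite mxE !eqxx.
by rewrite mxE eqxx (negbTE ji).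
Qed.

Definition dist1 (d : nat) (y z : lattice d) : nat := norm1 (y - z).

Lemma dist1C d (y z : lattice d) : dist1 y z = dist1 z y.
Proof. by rewrite /dist1 -norm1N opprB. Qed.

Lemma dist1zz d (z : lattice d) : dist1 z z = 0%N.
Proof. by rewrite /dist1 subrr norm1_0. Qed.

Lemma dist1_tri d (x y z : lattice d) : (dist1 x z <= dist1 x y + dist1 y z)%N.
Proof. by rewrite /dist1 -[x - z](subrKA y) norm1D. Qed.

Lemma norm1_tri d (y z : lattice d) : (norm1 y <= norm1 z + dist1 y z)%N.
Proof. by rewrite -[in X in (X <= _)%N](subrKC z y) norm1D. Qed.

Lemma norm1_step d (z : lattice d) n : norm1 z = n.+1 ->
  exists i, norm1 (z - unit_vec i) = n \/ norm1 (z + unit_vec i) = n.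
Proof.
move=> zn; have [i zi0] : exists i, z 0 i != 0.
  apply/not_existsP => z0; move: zn; rewrite /norm1 big1// => i _.
  by have /negP/negPn/eqP -> := z0 i.
have rest (s : int) : \sum_(j < d | j != i) `|((z + s *: unit_vec i)%R 0%R j)|%N =
    \sum_(j < d | j != i) `|(z 0%R j)|%N.
  by apply: eq_bigr => j ji; rewrite !mxE (negbTE ji) andbF mulr0 addr0.
have n1 (s : int) : norm1 (z + s *: unit_vec i) =
    (`|(z 0 i + s)%R| + \sum_(j < d | j != i) `|(z 0%R j)|)%N.
  by rewrite /norm1 (bigD1 i)//= [X in (_ + X)%N]rest !mxE !eqxx mulr1.
have {}zn : (`|(z 0%R i)| + \sum_(j < d | j != i) `|(z 0%R j)|)%N = n.+1.
  by rewrite -zn /norm1 [RHS](bigD1 i).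
exists i; have [zp|zneg] := leP 0 (z 0 i).
- by left; have := n1 (-1); rewrite scaleN1r => ->; move: (z 0 i) zi0 zp zn; lia.
- by right; have := n1 1; rewrite scale1r => ->; move: (z 0 i) zi0 zneg zn; lia.
Qed.

(** * Neighbour sums and the coefficient recursion *)

Definition nbr_sum (R : realType) d (f : lattice d -> R) (z : lattice d) : R :=
  \sum_(i < d) (f (z + unit_vec i) + f (z - unit_vec i)).

Lemma dist1_nbr d (z : lattice d) i :
  (dist1 (z + unit_vec i) z = 1%N) * (dist1 (z - unit_vec i) z = 1%N).
Proof. by rewrite /dist1 addrAC subrr add0r addrAC subrr add0r norm1N
    norm1_unit. Qed.

Lemma nbr_sum_le (R : realType) d (f : lattice d -> R) (z : lattice d) (M : R) :
  (forall y, dist1 y z = 1%N -> f y <= M) -> nbr_sum f z <= 2 * d%:R * M.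
Proof.
move=> fM; have -> : 2 * d%:R * M = \sum_(i < d) (M + M).
  by rewrite sumr_const card_ord -mulr_natr; ring.
by apply: ler_sum => i _; apply: lerD; apply: fM; rewrite dist1_nbr.
Qed.

Lemma nbr_sum_mono (R : realType) d (f g : lattice d -> R) (z : lattice d) :
  (forall y, dist1 y z = 1%N -> f y <= g y) -> nbr_sum f z <= nbr_sum g z.
Proof.
by move=> fg; apply: ler_sum => i _; apply: lerD; apply: fg; rewrite dist1_nbr.
Qed.

Lemma nbr_sum_ge0 (R : realType) d (f : lattice d -> R) (z : lattice d) :
  (forall y, 0 <= f y) -> 0 <= nbr_sum f z.
Proof. by move=> f0; apply: sumr_ge0 => i _; exact: addr_ge0. Qed.

Lemma nbr_sum_eq0 (R : realType) d (f : lattice d -> R) (z : lattice d) :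
  (forall y, dist1 y z = 1%N -> f y = 0) -> nbr_sum f z = 0.
Proof.
by move=> f0; apply: big1 => i _; rewrite !f0 ?addr0// dist1_nbr.
Qed.

Lemma nbr_sumZ (R : realType) d (a : R) (f : lattice d -> R) (z : lattice d) :
  nbr_sum (fun y => a * f y) z = a * nbr_sum f z.
Proof. by rewrite mulr_sumr; apply: eq_bigr => i _; rewrite mulrDr. Qed.

Lemma nbr_sumZr (R : realType) d (a : R) (f : lattice d -> R) (z : lattice d) :
  nbr_sum (fun y => f y * a) z = nbr_sum f z * a.
Proof. by rewrite mulr_suml; apply: eq_bigr => i _; rewrite mulrDl. Qed.

Lemma nbr_sum_sum (R : realType) d (I : Type) (r : seq I) (P : pred I)
    (F : I -> lattice d -> R) (z : lattice d) :
  nbr_sum (fun y => \sum_(j <- r | P j) F j y) z =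
  \sum_(j <- r | P j) nbr_sum (F j) z.
Proof.
by rewrite exchange_big; apply: eq_bigr => i _; rewrite -big_split.
Qed.

Lemma laplacianE (R : realType) d (f : lattice d -> R) z :
  laplacian f z = nbr_sum f z - 2 * d%:R * f z.
Proof.
rewrite /laplacian /nbr_sum.
have -> : 2 * d%:R * f z = \sum_(i < d) (2 * f z).
  by rewrite sumr_const card_ord -mulr_natr; ring.
by rewrite -sumrB; apply: eq_bigr => i _; ring.
Qed.

(* [wcoef xi k z / k!] is the coefficient of [t ^ k] in [e^(2dt) u t z]: the
   constant [-2d] on the diagonal of the generator is removed so that all
   coefficients are nonnegative. *)
Fixpoint wcoef (R : realType) d (xi : lattice d -> R) (k : nat) (z : lattice d)
    : R :=
  if k is k'.+1 then xi z * wcoef xi k' z + nbr_sum (wcoef xi k') z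
  else (z == 0)%:R.

Lemma wcoefS (R : realType) d (xi : lattice d -> R) k z :
  wcoef xi k.+1 z = xi z * wcoef xi k z + nbr_sum (wcoef xi k) z.
Proof. by []. Qed.

Definition wpart (R : realType) d (xi : lattice d -> R) (n : nat) (t : R)
    (z : lattice d) : R := \sum_(k < n) wcoef xi k z * t ^+ k / k`!%:R.

Section coefficients.
Variables (R : realType) (d : nat) (xi : lattice d -> R).
Hypothesis xi_ge0 : forall z, 0 <= xi z.

Lemma wcoef_ge0 k z : 0 <= wcoef xi k z.
Proof.
elim: k z => [|k IH] z /=; first exact: ler0n.
by rewrite addr_ge0 ?mulr_ge0 ?nbr_sum_ge0.
Qed.

(** The recursion moves mass by at most one lattice step, so every coefficient has finite
    support. *)
Lemma wcoef_eq0 k z : (k < norm1 z)%N -> wcoef xi k z = 0.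
Proof.
elim: k z => [|k IH] z /= kz.
  by case: eqP kz => // ->; rewrite norm1_0.
rewrite IH ?mulr0 ?add0r; last by lia.
apply: nbr_sum_eq0 => y yz; apply: IH.
by have := norm1_tri z y; rewrite dist1C yz; lia.
Qed.

Lemma wcoef_norm1_ge1 n z : norm1 z = n -> 1 <= wcoef xi n z.
Proof.
elim: n z => [z /norm1_eq0 -> /=|n IH z zn]; first by rewrite eqxx.
have [i hi] := norm1_step zn; rewrite /=.
apply: ler_wpDl; first by rewrite mulr_ge0 ?wcoef_ge0.
rewrite /nbr_sum (bigD1 i)//=; apply: ler_wpDr.
  by apply: sumr_ge0 => j _; rewrite addr_ge0 ?wcoef_ge0.
case: hi => /IH h; [apply: ler_wpDl|apply: ler_wpDr] => //; exact: wcoef_ge0.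
Qed.

(** One path suffices: a shortest path to [z] counts at least 1, and the diagonal term is then used
    [m] times. *)
Lemma wcoef_ge m z : xi z ^+ m <= wcoef xi (norm1 z + m) z.
Proof.
elim: m => [|m IH]; first by rewrite addn0 wcoef_norm1_ge1.
rewrite addnS /= exprS; apply: ler_wpDr.
  by apply: nbr_sum_ge0 => y; exact: wcoef_ge0.
exact: ler_wpM2l.
Qed.

Lemma wpartS n t z : wpart xi n.+1 t z =
  wpart xi n t z + wcoef xi n z * t ^+ n / n`!%:R.
Proof. by rewrite /wpart big_ord_recr. Qed.

Lemma wpart_0 n z : wpart xi n.+1 0 z = (z == 0)%:R.
Proof.
rewrite /wpart big_ord_recl /= expr0 mulr1 divr1 big1 ?addr0// => i _.
by rewrite expr0n /= mulr0 mul0r.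
Qed.

(** Differentiation lowers the order of truncation by one, which makes the comparison with a
    solution an induction on [n]. *)
Lemma is_derive_wpart n (t : R) z :
  is_derive t 1 (fun s : R => wpart xi n.+1 s z)
    (xi z * wpart xi n t z + nbr_sum (wpart xi n t) z).
Proof.
have -> : xi z * wpart xi n t z + nbr_sum (wpart xi n t) z =
    \sum_(k < n) wcoef xi k.+1 z * t ^+ k / k`!%:R.
  rewrite nbr_sum_sum mulr_sumr -big_split /=; apply: eq_bigr => k _.
  by rewrite 2!nbr_sumZr; ring.
elim: n => [|n IH].
  rewrite big_ord0 (_ : (fun s => _) = cst ((z == 0)%:R)); last first.
    by apply/funext => s; rewrite /wpart big_ord1 /= expr0 mulr1 divr1.
  exact: is_derive_cst.
rewrite big_ord_recr /= (_ : (fun s => _) = (fun s => wpart xi n.+1 s z) +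
    (fun s => wcoef xi n.+1 z * s ^+ n.+1 / (n.+1)`!%:R)); last first.
  by apply/funext => s; rewrite wpartS.
apply: is_deriveD.
rewrite (_ : (fun s => _) = (wcoef xi n.+1 z / (n.+1)`!%:R) \*: (fun s => s ^+
    n.+1)); last first.
  by apply/funext => s; rewrite /= /GRing.scale /=; ring.
have : is_derive t 1 (fun s : R => s ^+ n.+1) (n.+1%:R * t ^+ n).
  have := @is_deriveX R R id n.+1 t 1 1 (is_derive_id _ _).
  by rewrite exprfctE /GRing.scale /= mulr1.
move=> h; apply: is_derive_eq; rewrite /GRing.scale /= factS natrM.
by field; rewrite nat1r !pnatr_eq0 -!lt0n fact_gt0.
Qed.

End coefficients.

Arguments wcoef : simpl never.

(** * Boxes and exponential sums over them *)

(** Points are encoded by functions on the coordinates, so that a sum of products over the box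
    factorises. *)
Definition box_point (d N : nat) (phi : {ffun 'I_d -> 'I_(2 * N + 1)}) :
    lattice d :=
  \row_i ((phi i)%:Z - N%:Z).

Definition box (d N : nat) : {fset lattice d} :=
  [fset box_point phi | phi in {ffun 'I_d -> 'I_(2 * N + 1)}]%fset.

Lemma box_point_inj d N : injective (@box_point d N).
Proof.
move=> p q /matrixP pq; apply/ffunP => i; apply/val_inj.
have := pq 0 i; rewrite !mxE; move: (p i) (q i) => [a ?] [b ?] /=; lia.
Qed.

Lemma mem_box d N (z : lattice d) :
  (z \in box d N) = [forall i, (`|(z 0%R i)| <= N)%N].
Proof.
apply/imfsetP/forallP => /= [[phi _ ->] i|zN].
  by rewrite mxE; move: (phi i) => [a ?] /=; lia.
have lt i : (`|(z 0%R i + N%:Z)%R| < 2 * N + 1)%N.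
  by have := zN i; move: (z 0 i) => a; lia.
exists [ffun i => Ordinal (lt i)] => //.
apply/matrixP => j i; rewrite ord1 !mxE ffunE /=.
by have := zN i; move: (z 0 i) => a; lia.
Qed.

Lemma coord_le_norm1 d (z : lattice d) i : (`|(z 0%R i)| <= norm1 z)%N.
Proof. by rewrite /norm1 (bigD1 i)//= leq_addr. Qed.

Lemma norm1_box d N (z : lattice d) : (norm1 z <= N)%N -> z \in box d N.
Proof.
move=> zN; rewrite mem_box; apply/forallP => i.
exact: leq_trans (coord_le_norm1 z i) zN.
Qed.

Lemma notin_box d N (z : lattice d) : z \notin box d N -> (N < norm1 z)%N.
Proof. by apply: contraR; rewrite -leqNgt; exact: norm1_box. Qed.

Lemma box_subset d N M : (N <= M)%N -> {subset box d N <= box d M}.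
Proof.
move=> NM z; rewrite !mem_box => /forallP zN; apply/forallP => i.
exact: leq_trans (zN i) NM.
Qed.

Lemma box_norm1 d N (z : lattice d) : z \in box d N -> (norm1 z <= d * N)%N.
Proof.
rewrite mem_box => /forallP zN; rewrite /norm1.
by rewrite -[X in (_ <= X * _)%N](card_ord d) -sum_nat_const; apply: leq_sum.
Qed.

Lemma card_box d N : (#|` box d N| <= (2 * N + 1) ^ d)%N.
Proof.
apply: (leq_trans (leq_imfset_card _ _ _)).
have -> : ((2 * N + 1) ^ d = #|{ffun 'I_d -> 'I_(2 * N + 1)}|)%N.
  by rewrite card_ffun !card_ord.
by rewrite cardE.
Qed.

Lemma sum_box_prod (R : realType) d N (h : int -> R) :
  \sum_(z <- box d N) \prod_(i < d) h (z 0 i) =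
  (\sum_(j < 2 * N + 1) h (j%:Z - N%:Z)) ^+ d.
Proof.
rewrite big_imfset /=; last by move=> p q _ _; exact: box_point_inj.
rewrite -[in RHS](card_ord d) -prodr_const.
rewrite (bigA_distr_bigA (fun (_ : 'I_d) (j : 'I_(2 * N + 1)) => h (j%:Z -
    N%:Z))) big_enum /=.
by apply: eq_bigr => phi _; apply: eq_bigr => i _; rewrite mxE.
Qed.

Lemma sum_centered (R : realType) N (h : nat -> R) :
  \sum_(j < 2 * N + 1) h `|j%:Z - N%:Z|%N = 2 * \sum_(j < N.+1) h j - h 0%N.
Proof.
rewrite -(big_mkord xpredT (fun j => h `|j%:Z - N%:Z|%N)).
rewrite (big_cat_nat (n := N))//=; last by lia.
rewrite (_ : (2 * N + 1)%N = (N + N.+1)%N); last by lia.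
rewrite -{3}[N]add0n big_addn addKn.
rewrite [X in _ + X](eq_big_nat _ _ (F2 := h)); last first.
  by move=> i _; congr h; lia.
rewrite big_nat_rev/= (eq_big_nat _ _ (F2 := fun i => h i.+1)); last first.
  by move=> i /andP[_ iN]; congr h; lia.
rewrite !big_mkord big_ord_recl /=.
by under [X in _ = 2 * (_ + X) - _]eq_bigr do rewrite /bump leq0n add1n;
  under [X in _ + (_ + X) = _]eq_bigr do rewrite /bump leq0n add1n; ring.
Qed.

Lemma sum_geom (R : realType) (x : R) n :
  (1 - x) * \sum_(k < n) x ^+ k = 1 - x ^+ n.
Proof.
have := subrXX 1 x n; rewrite expr1n => ->; congr (_ * _).
by apply: eq_bigr => i _; rewrite expr1n mul1r.
Qed.

(** A two-sided geometric sum in each coordinate; the [- 1] corrects the double count of 0. *)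
Lemma sum_box_exp (R : realType) d N (c : R) :
  \sum_(z <- box d N) expR (- (c * (norm1 z)%:R)) =
  (2 * \sum_(j < N.+1) expR (- c) ^+ j - 1) ^+ d.
Proof.
have -> : 2 * \sum_(j < N.+1) expR (- c) ^+ j - 1 =
    \sum_(j < 2 * N + 1) expR (- c) ^+ `|j%:Z - N%:Z|%N.
  by rewrite (sum_centered _ (fun j => expR (- c) ^+ j)) expr0.
rewrite -(sum_box_prod d N (fun x => expR (- c) ^+ `|x|%N));
    apply: eq_bigr => z _.
by rewrite prodrXr -expRM_natr mulNr.
Qed.

Lemma sum_box_exp_le (R : realType) d N (c : R) : 0 < c ->
  \sum_(z <- box d N) expR (- (c * (norm1 z)%:R)) <= (1 + 2 / c) ^+ d.
Proof.
move=> c0; rewrite sum_box_exp.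
set S := \sum_(_ < _) _; have S1 : 1 <= S.
  rewrite /S big_ord_recl expr0 lerDl; apply: sumr_ge0 => i _.
  by rewrite exprn_ge0 ?expR_ge0.
have SE : (1 - expR (- c)) * S <= 1.
  by rewrite sum_geom gerBl exprn_ge0 ?expR_ge0.
(* The bound [SE] reads [(exp c - 1) (S - 1) <= 1]; since [S >= 1], [exp c - 1] may be replaced by
   the smaller [c]. *)
have h : c * S <= 1 + c.
  have e1 := expR_ge1Dx c; have e0 := expR_gt0 c.
  have : expR c * ((1 - expR (- c)) * S) <= expR c by rewrite ler_piMr// ltW.
  rewrite mulrA mulrBr mulr1 expRxMexpNx_1; nra.
rewrite lerXn2r ?nnegrE; first by [].
- by lra.
- by rewrite addr_ge0// divr_ge0// ltW.
- by rewrite lerBlDr -(ler_pM2l c0) mulrCA;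
    have -> : c * (1 + 2 / c + 1) = 2 * (1 + c);
  [field; exact: lt0r_neq0|lra].
Qed.

(** Uses [1 - exp (- c) <= c], the converse of the preceding estimate. Both bounds are [(2 / c) ^ d]
    to leading order when [c] tends to 0 and [c N] to infinity. *)
Lemma sum_box_exp_ge (R : realType) d N (c : R) : 0 < c ->
  1 <= 2 * (1 - expR (- (c * N.+1%:R))) / c ->
  (2 * (1 - expR (- (c * N.+1%:R))) / c - 1) ^+ d <=
    \sum_(z <- box d N) expR (- (c * (norm1 z)%:R)).
Proof.
move=> c0 h; rewrite sum_box_exp.
have e1 := expR_ge1Dx (- c).
rewrite lerXn2r ?nnegrE ?subr_ge0//.
  by rewrite (@le_trans _ _ 2)// ?ler1n// ler_peMr// big_ord_recl expr0 lerDl;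
    apply: sumr_ge0 => i _; rewrite exprn_ge0 ?expR_ge0.
rewrite lerD2r -mulrA ler_wpM2l// ler_pdivrMr// -mulNr expRM_natr -sum_geom.
by rewrite mulrC ler_wpM2l//; [apply: sumr_ge0 => i _;
    rewrite exprn_ge0 ?expR_ge0|lra].
Qed.

Lemma card_ball d r (Z : {fset lattice d}) :
  (\sum_(z <- Z) (norm1 z <= r) <= (2 * r + 1) ^ d)%N.
Proof.
apply: leq_trans (card_box d r).
rewrite (eq_bigr (fun z => if (norm1 z <= r)%N then 1%N else 0%N)); last first.
  by move=> z _; case: leqP.
rewrite -big_mkcond big_fset_condE -card_fset_sum1; apply: fsubset_leq_card.
by apply/fsubsetP => z; rewrite !inE => /andP[_]; exact: norm1_box.
Qed.

(** * The minimal solution *)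

(** By the mean value theorem [f] is monotone on positive times; the initial value enters only as a
    right limit, as in the definition of a solution. *)
Lemma ge0_derive_ge_right_lim (R : realType) (f df : R -> R) (l : R) :
  (forall t : R, 0 < t -> is_derive t 1 f (df t)) ->
  (forall t, 0 < t -> 0 <= df t) ->
  f t @[t --> 0^'+] --> l -> forall t, 0 < t -> l <= f t.
Proof.
move=> fdf df0 fl t t0.
have nd s : 0 < s -> s < t -> f s <= f t.
  move=> s0 st.
  have dv x : x \in `]s, t[%R -> is_derive x 1 f (df x).
    by rewrite in_itv /= => /andP[sx _]; apply: fdf; rewrite (lt_trans s0).
  have [|c] := MVT st dv.
    apply: derivable_within_continuous => x; rewrite in_itv /= => /andP[sx _].
    by have [] := fdf x (lt_le_trans s0 sx).
  rewrite in_itv /= => /andP[sc _] e.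
  rewrite -subr_ge0 e mulr_ge0//; first by rewrite df0// (lt_trans s0).
  by rewrite subr_ge0 ltW.
apply: (cvgr_to_le fl).
near=> s; apply: nd; near: s; first exact: nbhs_right_gt.
exact: nbhs_right_lt.
Unshelve. all: by end_near.
Qed.

Lemma is_derive_expRM (R : realType) (a t : R) :
  is_derive t 1 (fun s : R => expR (a * s)) (a * expR (a * t)).
Proof.
have h : is_derive t 1 (fun s : R => a * s) a.
  have := @is_deriveZ R R R id a t 1 1 (is_derive_id _ _).
  by rewrite /GRing.scale /= mulr1.
have := is_derive1_comp (is_derive_expR (a * t)) h.
by rewrite mulrC.
Qed.

Lemma is_derive_cvg (R : realType) (f : R -> R) (df t : R) :
  is_derive t 1 f df -> f s @[s --> t] --> f t.
Proof.
by case=> ft _; exact/differentiable_continuous/derivable1_diffP.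
Qed.

Lemma cvg_nbr_sum (R : realType) d (f : nat -> lattice d -> R)
    (l : lattice d -> R) z :
  (forall y, f n y @[n --> \oo] --> l y) ->
  nbr_sum (f n) z @[n --> \oo] --> nbr_sum l z.
Proof.
move=> fl; apply: cvg_big => [|i _]; first exact: add_continuous.
by apply: cvgD; exact: fl.
Qed.

Lemma pseries_ord (R : realType) (c : nat -> R) (t : R) n :
  pseries c t n = \sum_(k < n) c k * t ^+ k.
Proof. by rewrite /pseries /series /= big_mkord. Qed.

Section solution.
Variables (R : realType) (d : nat) (xi : lattice d -> R).
Hypothesis xi_ge0 : forall z, 0 <= xi z.

Let rate : R := 2 * d%:R.

Lemma wpart_ge0 n t z : 0 <= t -> 0 <= wpart xi n t z.
Proof.
move=> t0; apply: sumr_ge0 => k _.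
by rewrite !mulr_ge0 ?invr_ge0 ?exprn_ge0 ?wcoef_ge0.
Qed.

(** Minimality. The difference of the two sides at order [n + 1] has right limit 0 at time 0, and
    its derivative is a nonnegative combination of the differences at order [n], nonnegative by
    induction. *)
Lemma wpart_le_sol v n t z : nonneg_pam_solution xi v -> 0 < t ->
  wpart xi n t z <= expR (2 * d%:R * t) * v t z.
Proof.
move=> [[vd v0] vge0]; elim: n t z => [|n IH] t z t0.
  by rewrite /wpart big_ord0 mulr_ge0 ?expR_ge0 ?vge0.
rewrite -subr_ge0.
pose f (s : R) := expR (rate * s) * v s z - wpart xi n.+1 s z.
pose g (s : R) (y : lattice d) := expR (rate * s) * v s y - wpart xi n s y.
have g0 s y : 0 < s -> 0 <= g s y by move=> s0; rewrite subr_ge0 IH.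
apply: (@ge0_derive_ge_right_lim R f
  (fun s => xi z * g s z + nbr_sum (g s) z) 0 _ _ _ t t0) => [s s0|s s0|].
- have h1 := is_derive_expRM rate s.
  have h2 := vd s z s0.
  have h3 := is_derive_wpart xi n s z.
  have h4 := is_deriveM h1 h2.
  have h5 := @is_deriveB _ _ _ _ _ _ _ _ _ h4 h3.
  apply: is_derive_eq h5 _.
  rewrite laplacianE /GRing.scale /= /g.
  have -> : nbr_sum (fun y => expR (rate * s) * v s y - wpart xi n s y) z =
      expR (rate * s) * nbr_sum (v s) z - nbr_sum (wpart xi n s) z.
    by rewrite -nbr_sumZ /nbr_sum -sumrB; apply: eq_bigr => i _; ring.
  by rewrite /rate; ring.
- by rewrite addr_ge0 ?nbr_sum_ge0 ?mulr_ge0// => *; exact: g0.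
- suff : f s @[s --> 0^'+] -->
      (expR (rate * 0) * (z == 0)%:R - wpart xi n.+1 0 z).
    by rewrite wpart_0 mulr0 expR0 mul1r subrr.
  apply: cvgB; first apply: cvgM.
  + apply: cvg_at_right_filter.
    exact: (is_derive_cvg (is_derive_expRM rate 0)).
  + exact: v0.
  + apply: cvg_at_right_filter.
    exact: (is_derive_cvg (is_derive_wpart xi n 0 z)).
Qed.

Definition wsum (t : R) (z : lattice d) : R := limn (fun n => wpart xi n t z).

Lemma nondecreasing_wpart t z : 0 <= t ->
  nondecreasing_seq (fun n => wpart xi n t z).
Proof.
move=> t0; apply/nondecreasing_seqP => n.
by rewrite wpartS lerDl !mulr_ge0 ?invr_ge0 ?exprn_ge0 ?wcoef_ge0.
Qed.

Lemma wpart_pseries z : (fun t n => wpart xi n t z) =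
  pseries (fun k => wcoef xi k z / k`!%:R).
Proof.
apply/funext => t; apply/funext => n.
by rewrite pseries_ord; apply: eq_bigr => i _; ring.
Qed.

(** Any nonnegative solution provides this bound through [wpart_le_sol]. *)
Hypothesis wpart_bounded : forall t z, 0 < t ->
  exists M, forall n, wpart xi n t z <= M.

Lemma is_cvg_wpart t z : 0 < t -> cvgn (fun n => wpart xi n t z).
Proof.
move=> t0; have [M hM] := wpart_bounded z t0.
apply: nondecreasing_is_cvgn; first exact/nondecreasing_wpart/ltW.
by exists M => _ [n _ <-].
Qed.

Lemma wcoef_pseries_diffs z : pseries_diffs (fun k => wcoef xi k z / k`!%:R) =
  (fun k => wcoef xi k.+1 z / k`!%:R).
Proof.
apply/funext => k; rewrite /pseries_diffs factS natrM.
by field; rewrite nat1r !pnatr_eq0 -!lt0n fact_gt0.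
Qed.

Lemma cvg_wpart_diffs t z : 0 < t ->
  pseries (fun k => wcoef xi k.+1 z / k`!%:R) t @ \oo -->
    xi z * wsum t z + nbr_sum (wsum t) z.
Proof.
move=> t0; rewrite (_ : pseries _ t =
   fun n => xi z * wpart xi n t z + nbr_sum (wpart xi n t) z); last first.
  apply/funext => n; rewrite nbr_sum_sum mulr_sumr -big_split /=.
  rewrite pseries_ord; apply: eq_bigr => k _.
  by rewrite 2!nbr_sumZr wcoefS; ring.
apply: cvgD; first by apply: cvgMl_tmp; exact: is_cvg_wpart.
by apply: cvg_nbr_sum => y; exact: is_cvg_wpart.
Qed.

(** Differentiating a power series term by term asks for convergence of its second derivative series
    too; the recursion expresses that series through the first one at [z] and its neighbours. *)
Lemma is_cvg_wpart_diffs2 t z : 0 < t ->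
  cvgn (pseries (fun k => wcoef xi k.+2 z / k`!%:R) t).
Proof.
move=> t0; pose s n y := \sum_(k < n) wcoef xi k.+1 y / k`!%:R * t ^+ k.
have sE y : s ^~ y = pseries (fun k => wcoef xi k.+1 y / k`!%:R) t.
  by apply/funext => n; rewrite pseries_ord.
rewrite (_ : pseries _ t = fun n => xi z * s n z + nbr_sum (s n) z); last first.
  apply/funext => n; rewrite pseries_ord.
  rewrite (nbr_sum_sum _ _ (fun (k : 'I_n) y => wcoef xi k.+1 y / k`!%:R * t ^+
      k)).
  rewrite mulr_sumr -big_split /=; apply: eq_bigr => k _.
  by rewrite 2!nbr_sumZr [wcoef xi k.+2 z]wcoefS; ring.
have cs y : cvgn (s ^~ y) by rewrite sE; apply/cvg_ex; eexists;
    exact: cvg_wpart_diffs.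
apply: is_cvgD; first by apply: is_cvgMl_tmp; exact: cs.
by apply/cvg_ex; eexists; apply: cvg_nbr_sum => y; exact: cs.
Qed.

Lemma is_derive_wsum (t : R) z : 0 <= t ->
  is_derive t 1 (fun s : R => wsum s z)
    (limn (pseries (fun k => wcoef xi k.+1 z / k`!%:R) t)).
Proof.
move=> t0.
(* Convergence holds at every positive time, so a larger radius is available. Including [t = 0]
   gives the continuity at 0 behind the initial condition. *)
have K0 : 0 < t + 1 by rewrite ltr_wpDl.
have := @pseries_snd_diffs R (fun k => wcoef xi k z / k`!%:R) (t + 1) t.
rewrite (_ : pseries_diffs (pseries_diffs _) = fun k => wcoef xi k.+2 z /
    k`!%:R); last first.
  rewrite wcoef_pseries_diffs; apply/funext => k;
      rewrite /pseries_diffs factS natrM.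
  by field; rewrite nat1r !pnatr_eq0 -!lt0n fact_gt0.
rewrite wcoef_pseries_diffs -wpart_pseries; apply.
- exact: is_cvg_wpart.
- by apply/cvg_ex; eexists; exact: cvg_wpart_diffs.
- exact: is_cvg_wpart_diffs2.
- by rewrite !ger0_norm ?ltrDl// ltW.
Qed.

Lemma wsum_0 z : wsum 0 z = (z == 0)%:R.
Proof.
apply/cvg_lim => //; rewrite -cvg_shiftS /=.
rewrite (_ : (fun n => _) = cst (z == 0)%:R); first exact: cvg_cst.
by apply/funext => n; rewrite wpart_0.
Qed.

Lemma wsum_sol :
  nonneg_pam_solution xi (fun t z => expR (- rate * t) * wsum t z).
Proof.
split; first split.
- move=> t z t0.
  have h1 := is_derive_expRM (- rate) t.
  have h2 := @is_derive_wsum t z (ltW t0).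
  have h4 := is_deriveM h1 h2.
  apply: is_derive_eq h4 _.
  rewrite (cvg_lim _ (cvg_wpart_diffs t0))// laplacianE /GRing.scale /=.
  by rewrite nbr_sumZ /rate; ring.
- move=> z.
  suff : expR (- rate * s) * wsum s z @[s --> 0^'+] --> expR (- rate * 0) *
      wsum 0 z.
    by rewrite wsum_0 mulr0 expR0 mul1r.
  apply: cvg_at_right_filter; apply: cvgM.
    exact: (is_derive_cvg (is_derive_expRM (- rate) 0)).
  exact: (is_derive_cvg (@is_derive_wsum 0 z (lexx _))).
- move=> t z t0; apply: mulr_ge0; first exact: expR_ge0.
  apply: limr_ge; first exact: is_cvg_wpart.
  by apply: nearW => n; apply/wpart_ge0/ltW.
Qed.

End solution.

(** The given solution bounds the series, the sum of the series is then a nonnegative solution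
    itself, and uniqueness identifies the two. *)
Lemma unique_sol_wsum (R : realType) d (xi : lattice d -> R) v t z :
  (forall z, 0 <= xi z) -> unique_nonneg_pam_solution xi v -> 0 < t ->
  cvgn (fun n => wpart xi n t z) /\
  v t z = expR (- (2 * d%:R * t)) * limn (fun n => wpart xi n t z).
Proof.
move=> xi0 [vsol vuniq] t0.
have bd s y : 0 < s -> exists M, forall n, wpart xi n s y <= M.
  move=> s0; exists (expR (2 * d%:R * s) * v s y) => n.
  exact: wpart_le_sol.
split; first exact: is_cvg_wpart.
by rewrite -(vuniq _ (wsum_sol xi0 bd))// mulNr.
Qed.

(** * A supersolution for sparse high sites *)

Section clamp.
Variables (R : realType) (d : nat) (theta : R) (f : lattice d -> R).
Hypothesis theta_ge0 : 0 <= theta.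
Hypothesis fL : forall y z, `|f y - f z| <= (1 - theta) * (dist1 y z)%:R.

(** [f] cut off between two cones of slope 1 with apex value [f b]. The predecessor of the distance
    shifts the cones outwards by one step, so the result is constant on the closed unit ball around
    [b]. *)
Definition clamp (b z : lattice d) : R :=
  let r := ((dist1 z b).-1)%:R in
  Num.max (f b - r) (Num.min (f b + r) (f z)).

Lemma clamp_near b z : (dist1 z b <= 1)%N -> clamp b z = f b.
Proof.
move=> zb; rewrite /clamp; have -> : (dist1 z b).-1 = 0%N.
  by move: (dist1 _ _) zb => n; lia.
rewrite subr0 addr0 /Num.max /Num.min; case: (ltP (f b) (f z)) => h;
  case: ltP => //; lra.
Qed.

(** At distance [n] the function deviates from [f b] by at most [(1 - theta) n], which is within the
    opening [n - 1] of the cones once [theta n >= 1]. *)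
Lemma clamp_far b z : 1 <= theta * (dist1 z b)%:R -> clamp b z = f z.
Proof.
move=> zb; have := fL z b; rewrite /clamp.
case: (dist1 z b) zb => [|n]; first by rewrite mulr0; lra.
rewrite -natr1 /= ler_norml => h /andP[h1 h2]; rewrite /Num.max /Num.min.
by case: (ltP (f b + n%:R) (f z)) => h3; case: ltP => h4 //; lra.
Qed.

Lemma clamp_dist b z : `|clamp b z - f z| <= 1.
Proof.
have := fL z b; rewrite /clamp.
have : (dist1 z b)%:R <= (dist1 z b).-1%:R + 1 :> R.
  by rewrite natr1 ler_nat; lia.
have : 0 <= (dist1 z b)%:R :> R by [].
move: (dist1 _ _)%:R (_.-1)%:R => u v u0 uv; rewrite !ler_norml => /andP[h1 h2].
have h3 : (1 - theta) * u <= u by rewrite mulrBl mul1r gerBl mulr_ge0.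
rewrite /Num.max /Num.min.
by case: (ltP (f b + v) (f z)) => h4; case: ltP => h5; apply/andP; split; lra.
Qed.

Lemma clamp_lip b y z : dist1 y z = 1%N -> `|clamp b y - clamp b z| <= 1.
Proof.
move=> yz; have t0 : 0 <= theta by exact: theta_ge0.
have := fL y z; rewrite yz mulr1 /clamp.
have h1 : (dist1 y b).-1%:R <= (dist1 z b).-1%:R + 1 :> R.
  by rewrite natr1 ler_nat; have := dist1_tri y z b; lia.
have h2 : (dist1 z b).-1%:R <= (dist1 y b).-1%:R + 1 :> R.
  by rewrite natr1 ler_nat; have := dist1_tri z y b; rewrite (dist1C z y); lia.
have h0 : 0 <= (dist1 z b).-1%:R :> R by [].
have h0' : 0 <= (dist1 y b).-1%:R :> R by [].
move: ((dist1 z b).-1)%:R ((dist1 y b).-1)%:R h0 h0' h1 h2 => u v u0 v0 h1 h2.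
rewrite !ler_norml => /andP[h3 h4]; rewrite /Num.max /Num.min.
by case: (ltP (f b + u) (f z)) => h5; case: (ltP (f b + v) (f y)) => h6;
  case: ltP => h7; case: ltP => h8; apply/andP; split; lra.
Qed.

Variables (bad : pred (lattice d)) (m : nat).
Hypothesis theta_m : 1 <= theta * m%:R.
Hypothesis bad_sep : forall b b', bad b -> bad b' -> b != b' ->
  (2 * m + 1 < dist1 b b')%N.

(* Flattening [f] around the bad sites costs nothing in the unit Lipschitz
   constant along edges, because the slack [theta] is recovered within
   distance [m]. *)
Lemma flatten_exists : exists g : lattice d -> R,
  [/\ forall z, `|g z - f z| <= 1,
      forall y z, dist1 y z = 1%N -> `|g y - g z| <= 1 &
      forall b z, bad b -> dist1 z b = 1%N -> g z = g b].
Proof.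
pose P z b := bad b /\ (dist1 z b <= m)%N.
pose g z := match pselect (exists b, P z b) with
  | left h => clamp (projT1 (cid h)) z | right _ => f z end.
(* The formula extends one step beyond radius [m], where the cut-off already agrees with [f]. Hence
   both ends of an edge that touches a ball of radius [m] use the same [b]; the separation [2 m + 1]
   is what this needs. *)
have gnear b z : bad b -> (dist1 z b <= m.+1)%N -> g z = clamp b z.
  move=> bb zb; rewrite /g; case: pselect => [h|/forallNP h].
    case: cid => b' /= [bb' zb']; have [->//|/eqP bb'n] := pselect (b' = b).
    have := bad_sep bb' bb bb'n; have := dist1_tri b' z b.
    by rewrite (dist1C b' z); lia.
  rewrite clamp_far// (le_trans theta_m)// ler_wpM2l// ler_nat.
  by have := h b; rewrite /P; case: leqP => //; [move=> h1 []; split|lia].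
exists g; split.
- move=> z; rewrite /g; case: pselect => [h|_]; first exact: clamp_dist.
  by rewrite subrr normr0.
- have main y z : (exists b, P z b) -> dist1 y z = 1%N -> `|g y - g z| <= 1.
    move=> [b [bb zb]] yz; rewrite !(gnear b)//; first exact: clamp_lip.
    + lia.
    + by have := dist1_tri y z b; lia.
  move=> y z yz; have [hz|hz] := pselect (exists b, P z b); first exact: main.
  have [hy|hy] := pselect (exists b, P y b).
    by rewrite distrC main// dist1C.
  rewrite /g; case: pselect => // _; case: pselect => // _.
  by have := fL y z; rewrite yz mulr1 => /le_trans; apply; rewrite gerBl.
- move=> b z bb zb; rewrite !(gnear b)// ?zb//; last by rewrite dist1zz.
  by rewrite !clamp_near// ?zb// dist1zz.
Qed.

End clamp.

Lemma exp_partial_le (R : realType) (x : R) n : 0 <= x ->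
  \sum_(k < n) x ^+ k / k`!%:R <= expR x.
Proof.
move=> x0; have nd : nondecreasing_seq (series (exp_coeff x)).
  apply/nondecreasing_seqP => i; rewrite /series /= big_nat_recr//= lerDl.
  exact: exp_coeff_ge0.
have := nondecreasing_cvgn_le nd (is_cvg_series_exp_coeff x) n.
by rewrite /series /= big_mkord.
Qed.

Lemma sum_halves_le (R : realType) (x : R) n : 0 <= x <= 2^-1 ->
  \sum_(k < n) x ^+ k <= 2.
Proof.
move=> /andP[x0 x2]; suff : (1 - x) * \sum_(k < n) x ^+ k <= 1.
  have : 0 <= \sum_(k < n) x ^+ k by apply: sumr_ge0 => i _; exact: exprn_ge0.
  by move: (\sum_(_ < _) _) => s s0; nra.
rewrite sum_geom. by rewrite lerBlDr lerDl exprn_ge0.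
Qed.

(** * Levels that dominate the coefficients *)

Section supersolution.
Variables (R : realType) (d : nat) (xi : lattice d -> R).
(** [H] and [c] are the height and slope of the bound on the potential, [Lam] is the depth below it
    down to which sites count as bad, and [eps] is the excess of the growth rate. [C_eps] lets a
    raised bad site absorb its flat neighbours, [Lam_large] lets any other site absorb neighbours
    larger by [expR l], and [C_small] makes a raised neighbour no worse than that. [theta] is the
    slope given up for the flattening. *)
Variables (theta H Lam eps c l C : R) (m k : nat).
Hypothesis xi_ge0 : forall z, 0 <= xi z.
Hypothesis theta01 : 0 <= theta <= 1.
Hypothesis theta_m : 1 <= theta * m%:R.
Hypothesis k_gt0 : (0 < k)%N.
Hypothesis H_ge0 : 0 <= H.
Hypothesis eps_gt0 : 0 < eps.
Hypothesis c_ge0 : 0 <= c.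
Hypothesis l_ge0 : 0 <= l.
Hypothesis C_ge1 : 1 <= C.
Hypothesis C_small : C <= expR l.
Hypothesis C_eps : 4 * d%:R <= eps * C.
Hypothesis Lam_large : 2 * d%:R * expR l + 2 * d%:R <= Lam.

Definition bad_site (z : lattice d) : bool := H - Lam + c * (norm1 z)%:R < xi z.

Hypothesis xi_le : forall z, xi z <= H + c * (norm1 z)%:R.
Hypothesis bad_sep : forall b b', bad_site b -> bad_site b' -> b != b' ->
  (2 * m + 1 < dist1 b b')%N.

(* Level [j] is the ball of radius [k * j], and [expR (- l)] is the cost of one
   step.  The profile at level [j] decays outwards from radius [k * (j - 1)] on:
   the truncated [norm1 z + k - k * j] is the distance to that smaller ball.  The
   loss of [4] in [level_amp] pays for the factor [C], the flattening errors and
   the step across the boundary of a level. *)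
Definition level_rate (j : nat) : R := H + eps + c * (k * j)%:R.

Definition level_dist (j : nat) (z : lattice d) : R :=
  (1 - theta) * (norm1 z + k - k * j)%:R.

Definition level_amp (j : nat) : R :=
  expR (l * ((1 - theta) * k%:R + 1)) *
  expR (- (l * ((1 - theta) * k%:R - 4))) ^+ j.

Definition level_prof (g : nat -> lattice d -> R) (j : nat) (z : lattice d) : R :=
  (if bad_site z then C else 1) * expR (- (l * g j z)).

Definition level_sol (g : nat -> lattice d -> R) (J n : nat) (z : lattice d) :
    R :=
  \sum_(j < J.+1) (norm1 z <= k * j)%:R *
    (level_amp j * level_rate j ^+ n * level_prof g j z).

Lemma level_dist_lip j y z :
  `|level_dist j y - level_dist j z| <= (1 - theta) * (dist1 y z)%:R.
Proof.
have /andP[_ t1] := theta01.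
rewrite -mulrBr normrM ger0_norm ?subr_ge0// ler_wpM2l ?subr_ge0//.
have h1 := norm1_tri y z; have h2 := norm1_tri z y.
rewrite dist1C in h2.
rewrite ler_norml lerBlDr -natrD ler_nat lerNl opprB lerBlDr -natrD ler_nat.
by clear -h1 h2; apply/andP; split; lia.
Qed.

Lemma level_rate_ge0 j : 0 <= level_rate j.
Proof. by rewrite !addr_ge0 ?mulr_ge0// ltW. Qed.

Lemma level_rate_mono j : level_rate j <= level_rate j.+1.
Proof. by rewrite lerD2l ler_wpM2l// ler_nat leq_mul2l leqnSn orbT. Qed.

Lemma level_amp_ge0 j : 0 <= level_amp j.
Proof. by rewrite mulr_ge0 ?exprn_ge0 ?expR_ge0. Qed.

Lemma C_ge0 : 0 <= C. Proof. exact: le_trans ler01 C_ge1. Qed.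

Section profile.
Variable g : nat -> lattice d -> R.
Hypothesis g_dist : forall j z, `|g j z - level_dist j z| <= 1.
Hypothesis g_lip : forall j y z, dist1 y z = 1%N -> `|g j y - g j z| <= 1.
Hypothesis g_flat : forall j b z, bad_site b -> dist1 z b = 1%N ->
  g j z = g j b.

Let e j z := expR (- (l * g j z)).

Lemma level_prof_ge0 j z : 0 <= level_prof g j z.
Proof. by rewrite mulr_ge0 ?expR_ge0//; case: ifP => // _; exact: C_ge0. Qed.

Lemma level_prof_le j z : level_prof g j z <= C * expR l.
Proof.
rewrite ler_pM ?expR_ge0//; first by case: ifP => // _; exact: C_ge0.
  by case: ifP.
rewrite ler_expR -mulrN; have /andP[_ t1] := theta01.
have : 0 <= level_dist j z by rewrite mulr_ge0 ?subr_ge0.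
have := g_dist j z; rewrite ler_norml => /andP[h1 h2] h3.
by rewrite ler_piMr//; lra.
Qed.

(** At a bad site no neighbour is bad and [g] is flat, so the neighbours weigh [2 d] in units of
    [e j z], against a gain of at least [eps C >= 4 d]. At any other site the potential is at least
    [Lam] below the rate and each neighbour weighs at most [expR l], a bad one because [g] is flat
    there. Either case leaves a surplus of [2 d]. *)
Lemma level_prof_step j z : (norm1 z <= k * j)%N ->
  xi z * level_prof g j z + nbr_sum (level_prof g j) z + 2 * d%:R * e j z <=
  level_rate j * level_prof g j z.
Proof.
move=> zj; have zj' : (norm1 z)%:R <= (k * j)%:R :> R by rewrite ler_nat.
have czj : c * (norm1 z)%:R <= c * (k * j)%:R by rewrite ler_wpM2l.
have e0 : 0 <= e j z by exact: expR_ge0.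
have d0 : 0 <= d%:R :> R by [].
have eps0 := eps_gt0.
have [bz|bz] := boolP (bad_site z).
  have : nbr_sum (level_prof g j) z <= 2 * d%:R * e j z.
    apply: nbr_sum_le => y yz; rewrite /level_prof ifF.
      by rewrite mul1r (g_flat _ bz).
    apply/negP => bY; have yz' : y != z.
      by apply/eqP => yE; move: yz; rewrite yE dist1zz.
    by have := bad_sep bY bz yz'; rewrite yz addnC ltnNge leq_addr.
  have -> : level_prof g j z = C * e j z by rewrite /level_prof bz.
  rewrite /level_rate => hS.
  have hC : 4 * d%:R * e j z <= eps * C * e j z by rewrite ler_wpM2r.
  have hx : eps * (C * e j z) <= (H + eps + c * (k * j)%:R - xi z) * (C * e j z).
    rewrite ler_wpM2r ?mulr_ge0 ?C_ge0//.
    by have := xi_le z; lra.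
  by lra.
have : nbr_sum (level_prof g j) z <= 2 * d%:R * (expR l * e j z).
  apply: nbr_sum_le => y yz; rewrite /level_prof; case: ifP => bY.
    have gE : g j z = g j y by apply: g_flat => //; rewrite dist1C.
    by rewrite /e gE ler_wpM2r ?expR_ge0.
  rewrite mul1r -expRD ler_expR.
  have := g_lip j yz; rewrite ler_norml => /andP[h1 h2].
  by rewrite -!mulrN -[X in X + _]mulr1 -mulrDr ler_wpM2l//; lra.
have -> : level_prof g j z = e j z by rewrite /level_prof (negbTE bz) mul1r.
rewrite /level_rate.
move: bz; rewrite -leNgt => bz hS.
have hL : (2 * d%:R * expR l + 2 * d%:R) * e j z <= Lam * e j z by rewrite
    ler_wpM2r.
have hx : Lam * e j z <= (H + eps + c * (k * j)%:R - xi z) * e j z.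
  by rewrite ler_wpM2r//; lra.
by lra.
Qed.

Lemma level_entry j y z : norm1 z = (k * j).+1 -> (norm1 y <= k * j)%N ->
  dist1 y z = 1%N -> level_amp j * level_prof g j y <= level_amp j.+1 * e j.+1 z.
Proof.
move=> zj yj yz; have yE : norm1 y = (k * j)%N.
  by have := norm1_tri z y; rewrite dist1C yz zj; clear -yj; lia.
have /andP[t0 t1] := theta01.
have hy : level_dist j y = (1 - theta) * k%:R.
  by rewrite /level_dist yE addKn.
have hz : level_dist j.+1 z = 1 - theta.
  by rewrite /level_dist zj (_ : (_ - _)%N = 1%N) ?mulr1//; clear; lia.
rewrite /level_amp exprSr -!mulrA ler_wpM2l ?expR_ge0// ler_wpM2l ?exprn_ge0
    ?expR_ge0//.
rewrite -expRD; apply: (@le_trans _ _ (expR l * expR (- (l * g j y)))).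
  by rewrite ler_wpM2r ?expR_ge0//; case: ifP => // _; exact: le_trans C_ge1 _.
rewrite -expRD ler_expR.
have := g_dist j y; have := g_dist j.+1 z; rewrite hy hz.
rewrite !ler_norml => /andP[h1 h2] /andP[h3 h4].
(* The count against 4, in units of [l]: one for [C], one for each of two flattening errors, and
   [1 - theta] for the step across the boundary. *)
rewrite -!mulrN -mulrDr -[X in X + _]mulr1 -mulrDr ler_wpM2l//; lra.
Qed.

Lemma level_term_ge0 n j z : 0 <= (norm1 z <= k * j)%:R *
  (level_amp j * level_rate j ^+ n * level_prof g j z).
Proof.
apply: mulr_ge0 => //; apply: mulr_ge0; last exact: level_prof_ge0.
by apply: mulr_ge0; [exact: level_amp_ge0|exact/exprn_ge0/level_rate_ge0].
Qed.

(** This fixes the prefactor of [level_amp]: at the origin [level_dist 0] is [(1 - theta) k], and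
    flattening adds at most 1. *)
Lemma level_init J : 1 <= level_sol g J 0 (0 : lattice d).
Proof.
rewrite /level_sol big_ord_recl /= norm1_0 muln0 leqnn mul1r expr0 mulr1.
apply: ler_wpDr.
  apply: sumr_ge0 => j _; have := level_term_ge0 0 (lift ord0 j) 0.
  by rewrite norm1_0.
apply: (@le_trans _ _ (level_amp 0 * expR (- (l * g 0 0)))); last first.
  rewrite ler_wpM2l ?level_amp_ge0// ler_peMl ?expR_ge0//.
  by case: ifP => // _; exact: C_ge1.
rewrite /level_amp expr0 mulr1 -expRD -[leLHS]expR0 ler_expR -mulrBr mulr_ge0//.
have := g_dist 0 0; rewrite {1}/level_dist norm1_0 muln0 subn0 add0n.
by rewrite ler_norml => /andP[h1 h2]; lra.
Qed.

Lemma level_sol_ge0 J n z : 0 <= level_sol g J n z.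
Proof.
by apply: sumr_ge0 => j _; exact: level_term_ge0.
Qed.

(* The surplus of level [j + 1] at its inner boundary pays for the mass that
   leaves level [j]. *)
Lemma level_sol_step J n z : (norm1 z <= k * J)%N ->
  xi z * level_sol g J n z + nbr_sum (level_sol g J n) z <= level_sol g J n.+1 z.
Proof.
move=> zJ; pose S j := (norm1 z <= k * j)%:R * (level_amp j * level_rate j ^+ n
    * (2 * d%:R * e j z)).
have S0 j : 0 <= S j.
  by rewrite !mulr_ge0 ?exprn_ge0 ?level_rate_ge0 ?level_amp_ge0 ?expR_ge0.
pose a j := level_amp j * level_rate j ^+ n.
have a0 j : 0 <= a j by rewrite mulr_ge0 ?exprn_ge0 ?level_rate_ge0
    ?level_amp_ge0.
pose T j := xi z * ((norm1 z <= k * j)%:R * (a j * level_prof g j z)) +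
  nbr_sum (fun y => (norm1 y <= k * j)%:R * (a j * level_prof g j y)) z.
pose V j := (norm1 z <= k * j)%:R * (level_amp j * level_rate j ^+ n.+1 *
    level_prof g j z).
have hin j : (norm1 z <= k * j)%N -> T j <= V j - S j.
  move=> zj; rewrite /T /V /S zj !mul1r.
  have : nbr_sum (fun y => (norm1 y <= k * j)%:R * (a j * level_prof g j y)) z
      <= a j * nbr_sum (level_prof g j) z.
    rewrite -nbr_sumZ; apply: nbr_sum_mono => y _.
    by case: leqP; rewrite ?mul1r ?mul0r// mulr_ge0 ?a0 ?level_prof_ge0.
  have := ler_wpM2l (a0 j) (level_prof_step zj).
  have -> : level_amp j * level_rate j ^+ n.+1 * level_prof g j z =
      a j * (level_rate j * level_prof g j z) by rewrite /a exprSr; ring.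
  rewrite -/(a j); set N1 := nbr_sum _ _; set N2 := nbr_sum _ _ => h1 h2.
  by move: h1 h2; lra.
have hout j : (k * j < norm1 z)%N -> T j <= V j - S j + S j.+1.
  move=> zj; rewrite /T /V /S leqNgt zj !mul0r mulr0 subr0 !add0r.
  (* Beyond level [j + 1] as well, no neighbour can lie in level [j], because levels grow by
     [k >= 1]. *)
  have [zj'|zj'] := leqP (norm1 z) (k * j.+1); last first.
    rewrite mul0r le_eqVlt nbr_sum_eq0 ?eqxx// => y yz.
    rewrite leqNgt (_ : (k * j < norm1 y)%N) ?mul0r//.
    by have := norm1_tri z y; rewrite dist1C yz; clear -zj' k_gt0;
        rewrite mulnS in zj' *; lia.
  rewrite mul1r mulrCA; apply: nbr_sum_le => y yz.
  have [yj|yj] := leqP (norm1 y) (k * j); last first.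
    by rewrite mul0r; apply: mulr_ge0; [exact: a0|exact: expR_ge0].
  rewrite mul1r; apply: (@le_trans _ _ (level_rate j ^+ n * (level_amp j.+1 * e
      j.+1 z))).
    rewrite /a [level_amp j * _]mulrC -mulrA ler_wpM2l ?exprn_ge0
        ?level_rate_ge0//.
    apply: level_entry => //.
    by have := norm1_tri z y; rewrite dist1C yz; clear -zj yj; lia.
  rewrite [leRHS](_ : _ = level_rate j.+1 ^+ n * (level_amp j.+1 * e j.+1 z));
      last by ring.
  apply: ler_wpM2r; first by apply: mulr_ge0;
      [exact: level_amp_ge0|exact: expR_ge0].
  by rewrite lerXn2r ?nnegrE ?level_rate_ge0 ?level_rate_mono.
have -> : xi z * level_sol g J n z + nbr_sum (level_sol g J n) z = \sum_(j <
    J.+1) T j.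
  rewrite /level_sol nbr_sum_sum mulr_sumr -big_split /=.
  by apply: eq_bigr => j _.
rewrite (_ : level_sol _ _ _ _ = \sum_(j < J.+1) V j); last by [].
(* The surpluses telescope to [S J - S 0]. The top level contains [z], so it contributes [- S J] and
   needs no further level. *)
rewrite big_ord_recr [leRHS]big_ord_recr /=.
have h1 : \sum_(j < J) T j <= \sum_(j < J) (V j + (S j.+1 - S j)).
  apply: ler_sum => j _; have [zj|zj] := leqP (norm1 z) (k * j).
    by apply: (le_trans (hin _ zj)); have := S0 j.+1; lra.
  by apply: (le_trans (hout _ zj)); lra.
have h2 : \sum_(j < J) (S j.+1 - S j) = S J - S 0%N.
  by rewrite -telescope_sumr// big_mkord.
have h3 := hin _ zJ; have h4 := S0 0%N.
by move: h1; rewrite [leRHS]big_split /= h2; lra.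
Qed.

(** Finitely many levels suffice: beyond radius [k J] the coefficients of order up to [k J]
    vanish. *)
Lemma wcoef_le_level_sol J n z : (n <= k * J)%N -> wcoef xi n z <= level_sol g
    J n z.
Proof.
elim: n z => [|n IH] z nJ.
  rewrite /wcoef; case: eqP => [->|_]; first exact: level_init.
  exact: level_sol_ge0.
have [zJ|zJ] := leqP (norm1 z) (k * J); last first.
  by rewrite wcoef_eq0 ?level_sol_ge0// (leq_ltn_trans nJ).
rewrite wcoefS; apply: (le_trans _ (level_sol_step _ zJ)); apply: lerD.
  by rewrite ler_wpM2l// IH// ltnW.
by apply: nbr_sum_mono => y _; apply: IH; exact: ltnW.
Qed.


(** The order enters the bound only as a power of [level_rate j], so summing against [t ^ n / n!]
    yields one exponential per level. *)
Lemma wpart_le_level J n t z : (n <= k * J)%N -> 0 <= t ->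
  wpart xi n t z <=
  \sum_(j < J.+1) (norm1 z <= k * j)%:R * (level_amp j * (C * expR l) * expR
      (level_rate j * t)).
Proof.
move=> nJ t0; apply: (@le_trans _ _ (\sum_(i < n) level_sol g J i z * t ^+ i /
    i`!%:R)).
  apply: ler_sum => i _; rewrite !ler_wpM2r ?invr_ge0 ?exprn_ge0//
      wcoef_le_level_sol//.
  by rewrite (leq_trans (ltnW (ltn_ord i))).
rewrite /level_sol; under eq_bigr do rewrite -mulrA mulr_suml.
rewrite exchange_big /=; apply: ler_sum => j _.
under eq_bigr do rewrite -mulrA; rewrite -mulr_sumr ler_wpM2l//.
rewrite (eq_bigr (fun i : 'I_n => (level_amp j * level_prof g j z) *
    ((level_rate j * t) ^+ i / i`!%:R))); last first.
  by move=> i _; rewrite exprMn; ring.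
rewrite -mulr_sumr; apply: ler_pM.
- by rewrite mulr_ge0 ?level_amp_ge0 ?level_prof_ge0.
- by apply: sumr_ge0 => i _; rewrite mulr_ge0 ?invr_ge0 ?exprn_ge0 ?mulr_ge0
    ?level_rate_ge0.
- by rewrite ler_wpM2l ?level_amp_ge0 ?level_prof_le.
- by rewrite exp_partial_le// mulr_ge0 ?level_rate_ge0.
Qed.

(** Per level, the time exponent grows by [c t k] and the ball count by at most a factor
    [exp (2 k d)]; the decay of the amplitude beats both by a further factor [exp 1 >= 2]. *)
Lemma level_term_le j t : 0 <= t ->
  c * t * k%:R + 2 * k%:R * d%:R + 1 <= l * ((1 - theta) * k%:R - 4) ->
  level_amp j * expR (level_rate j * t) * ((2 * (k * j) + 1) ^ d)%:R <=
  expR (l * ((1 - theta) * k%:R + 1)) * expR ((H + eps) * t) * 2^-1 ^+ j.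
Proof.
move=> t0 ht.
have h1 : ((2 * (k * j) + 1) ^ d)%:R <= expR (2 * k%:R * d%:R) ^+ j :> R.
  rewrite natrX natrD !natrM -expRM_natr mulrAC expRM_natr lerXn2r ?nnegrE
      ?expR_ge0//.
  by have := expR_ge1Dx (2 * k%:R * j%:R : R); rewrite addrC mulrA.
have h2 : expR (-1) <= 2^-1 :> R.
  rewrite expRN lef_pV2 ?posrE ?expR_gt0//.
  by have := expR_ge1Dx (1 : R); rewrite (_ : 1 + 1 = 2).
have -> : expR (level_rate j * t) =
    expR ((H + eps) * t) * expR (c * ((k * j)%:R * t)).
  by rewrite -expRD /level_rate; congr expR; ring.
set A0 := expR (l * ((1 - theta) * k%:R + 1)).
rewrite [leLHS](_ : _ = A0 * expR ((H + eps) * t) *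
  (expR (- (l * ((1 - theta) * k%:R - 4))) ^+ j *
   (expR (c * ((k * j)%:R * t)) * ((2 * (k * j) + 1) ^ d)%:R))); last first.
  by rewrite /level_amp -/A0; ring.
rewrite ler_wpM2l ?mulr_ge0 ?expR_ge0//.
apply: (@le_trans _ _ (expR (-1) ^+ j)); last first.
  by rewrite lerXn2r ?nnegrE ?expR_ge0.
apply: (@le_trans _ _ (expR (- (l * ((1 - theta) * k%:R - 4))) ^+ j *
   (expR (c * ((k * j)%:R * t)) * expR (2 * k%:R * d%:R) ^+ j))).
  by rewrite !ler_wpM2l ?exprn_ge0 ?expR_ge0.
rewrite (_ : c * _ = c * t * k%:R * j%:R); last by rewrite natrM; ring.
rewrite [X in _ * (X * _)]expRM_natr -!exprMn -!expRD.
rewrite lerXn2r ?nnegrE ?expR_ge0// ler_expR; lra.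
Qed.

(** The levels form a geometric series of ratio 1/2, so the bound depends neither on [Z] nor on [n]
    and survives both limits in the total mass. *)
Lemma sum_wpart_le (Z : {fset lattice d}) n t : 0 <= t ->
  c * t * k%:R + 2 * k%:R * d%:R + 1 <= l * ((1 - theta) * k%:R - 4) ->
  \sum_(z <- Z) wpart xi n t z <=
  2 * C * expR (l * ((1 - theta) * k%:R + 2)) * expR ((H + eps) * t).
Proof.
move=> t0 ht.
pose F j := level_amp j * (C * expR l) * expR (level_rate j * t).
have F0 j : 0 <= F j.
  by rewrite !mulr_ge0 ?level_amp_ge0 ?expR_ge0 ?C_ge0.
have : \sum_(z <- Z) wpart xi n t z <=
    \sum_(z <- Z) \sum_(j < n.+1) (norm1 z <= k * j)%:R * F j.
  by apply: ler_sum => z _; apply: wpart_le_level => //; rewrite leq_pmull.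
move=> /le_trans; apply; rewrite exchange_big /=.
pose G := expR (l * ((1 - theta) * k%:R + 1)) * expR ((H + eps) * t).
apply: (@le_trans _ _ (\sum_(j < n.+1) (C * expR l) * (G * 2^-1 ^+ j))).
  apply: ler_sum => j _; rewrite -mulr_suml -natr_sum.
  apply: (@le_trans _ _ (((2 * (k * j) + 1) ^ d)%:R * F j)).
    by rewrite ler_wpM2r// ler_nat card_ball.
  rewrite /F (_ : _ * _ = C * expR l *
    (level_amp j * expR (level_rate j * t) * ((2 * (k * j) + 1) ^ d)%:R));
        last by ring.
  by rewrite ler_wpM2l ?level_term_le// mulr_ge0 ?expR_ge0 ?C_ge0.
rewrite -!mulr_sumr.
apply: (@le_trans _ _ (C * expR l * (G * 2))).
  rewrite !ler_wpM2l ?mulr_ge0 ?expR_ge0 ?C_ge0// sum_halves_le// lexx andbT.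
  by rewrite invr_ge0.
rewrite /G (_ : l * ((1 - theta) * k%:R + 2) = l + l * ((1 - theta) * k%:R +
    1)); last by ring.
by rewrite expRD le_eqVlt; apply/orP; left; apply/eqP; ring.
Qed.

End profile.

Lemma total_wpart_le (Z : {fset lattice d}) n t : 0 <= t ->
  c * t * k%:R + 2 * k%:R * d%:R + 1 <= l * ((1 - theta) * k%:R - 4) ->
  \sum_(z <- Z) wpart xi n t z <=
  2 * C * expR (l * ((1 - theta) * k%:R + 2)) * expR ((H + eps) * t).
Proof.
have /andP[theta0 _] := theta01.
have /choice[g hg] j := flatten_exists theta0 (level_dist_lip j) theta_m bad_sep.
by apply: (@sum_wpart_le g) => j; have [] := hg j.
Qed.

End supersolution.

(** * Bounds on the growth rate *)

Lemma lne_le (R : realType) (x : \bar R) (r : R) :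
  (x <= (expR r)%:E -> lne x <= r%:E)%E.
Proof.
case: x => [x| |] /=; [|by []|by move=> _; exact: leNye].
rewrite lee_fin => xr; case: ifPn => [_|]; first exact: leNye.
by rewrite -ltNge => x0; rewrite lee_fin -ler_expR lnK.
Qed.

Lemma lne_ge (R : realType) (x : \bar R) (r : R) :
  ((expR r)%:E <= x -> r%:E <= lne x)%E.
Proof.
case: x => [x| |] /=; [|by move=> _; exact: leey|by []]; rewrite lee_fin => xr.
have x0 : 0 < x by exact: lt_le_trans (expR_gt0 r) xr.
case: ifPn => [|_]; first by rewrite leNgt x0.
by rewrite lee_fin -ler_expR lnK.
Qed.

Lemma growth_rate_le (R : realType) d (v : R -> lattice d -> R) (t a : R) :
  0 < t -> (total_mass v t <= (expR (t * a))%:E -> growth_rate v t <= a%:E)%E.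
Proof.
move=> t0 /lne_le h; rewrite /growth_rate -[a](mulKf (lt0r_neq0 t0)) EFinM.
by rewrite lee_wpmul2l// lee_fin invr_ge0 ltW.
Qed.

Lemma growth_rate_ge (R : realType) d (v : R -> lattice d -> R) (t a : R) :
  0 < t -> ((expR (t * a))%:E <= total_mass v t -> a%:E <= growth_rate v t)%E.
Proof.
move=> t0 /lne_ge h; rewrite /growth_rate -[a](mulKf (lt0r_neq0 t0)) EFinM.
by rewrite lee_wpmul2l// lee_fin invr_ge0 ltW.
Qed.

Lemma growth_upper (R : realType) d (xi : lattice d -> R) v (t a : R) :
  (forall z, 0 <= xi z) -> unique_nonneg_pam_solution xi v -> 0 < t ->
  (forall (Z : {fset lattice d}) n, \sum_(z <- Z) wpart xi n t z <= expR (t *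
      a)) ->
  (growth_rate v t <= (a - 2 * d%:R)%:E)%E.
Proof.
move=> xi0 vsol t0 hB; apply: growth_rate_le => //.
apply: ub_ereal_sup => _ [Z [Zfin _] <-].
rewrite fsbig_finite//= sumEFin lee_fin.
rewrite mulrBr expRB ler_pdivlMr ?expR_gt0//.
rewrite (eq_bigr (fun z => expR (- (2 * d%:R * t)) * limn (fun n => wpart xi n
    t z))); last first.
  by move=> z _; have [_ ->] := unique_sol_wsum z xi0 vsol t0.
rewrite -mulr_sumr mulrAC (mulrC t) -expRD addNr expR0 mul1r.
have cv : \sum_(z <- fset_set Z) wpart xi n t z @[n --> \oo] -->
    \sum_(z <- fset_set Z) limn (fun n => wpart xi n t z).
  apply: cvg_big => [|z _]; first exact: add_continuous.
  by have [] := unique_sol_wsum z xi0 vsol t0.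
by apply: (cvgr_to_le cv); apply: nearW => n; exact: hB.
Qed.

(** A Chernoff bound: [x ^ k <= 2 ^ n (x / 2) ^ k] for [k < n]. *)
Lemma poisson_lower_tail (R : realType) (x : R) n : 0 <= x ->
  \sum_(k < n) x ^+ k / k`!%:R <= 2 ^+ n * expR (x / 2).
Proof.
move=> x0; have x20 : 0 <= x / 2 by rewrite divr_ge0.
apply: (@le_trans _ _ (2 ^+ n * \sum_(k < n) (x / 2) ^+ k / k`!%:R)); last first.
  by rewrite ler_wpM2l ?exprn_ge0// exp_partial_le.
rewrite mulr_sumr; apply: ler_sum => k _; rewrite mulrA ler_wpM2r ?invr_ge0//.
rewrite -{1}(divfK (_ : 2 != 0) x) ?pnatr_eq0// exprMn mulrC.
by rewrite ler_wpM2r ?exprn_ge0// ler_weXn2l ?ler1n// ltnW.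
Qed.

(** By [wcoef_ge], multiplying by [xi z ^+ norm1 z] turns the coefficients from order [norm1 z] on
    into at least those of [exp (xi z * t)]; only the first terms of that series are missing. *)
Lemma sol_mass_ge (R : realType) d (xi : lattice d -> R) v t z :
  (forall z, 0 <= xi z) -> nonneg_pam_solution xi v -> 0 < t -> 0 < xi z ->
  expR (xi z * t) - \sum_(k < norm1 z) (xi z * t) ^+ k / k`!%:R <=
  xi z ^+ norm1 z * (expR (2 * d%:R * t) * v t z).
Proof.
move=> xi0 vsol t0 xz; set x := xi z * t; set n := norm1 z.
have cv : series (exp_coeff x) @ \oo --> expR x by exact: is_cvg_series_exp_coeff.
rewrite lerBlDr; apply: (cvgr_to_le cv); near=> N.
have nN : (n <= N)%N by near: N; exact: nbhs_infty_ge.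
rewrite /series /= (big_cat_nat (n := n))//= addrC big_mkord lerD2r.
apply: (@le_trans _ _ (xi z ^+ n * wpart xi N t z)); last first.
  by rewrite ler_wpM2l ?exprn_ge0// wpart_le_sol.
rewrite /wpart -(big_mkord xpredT (fun k => wcoef xi k z * t ^+ k / k`!%:R)).
rewrite [X in _ <= _ * X](big_cat_nat (n := n))//= mulrDr; apply: ler_wpDl.
  rewrite mulr_ge0 ?exprn_ge0//; apply: sumr_ge0 => k _.
  by rewrite !mulr_ge0 ?invr_ge0 ?exprn_ge0 ?wcoef_ge0// ltW.
rewrite mulr_sumr; apply: ler_sum_nat => k /andP[nk _].
rewrite /exp_coeff /= /x exprMn -{1}(subnKC nk) exprD !mulrA.
rewrite !ler_wpM2r ?invr_ge0 ?exprn_ge0// ?(ltW t0)// ler_wpM2l ?exprn_ge0//.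
by rewrite -{2}(subnKC nk) wcoef_ge.
Unshelve. all: by end_near.
Qed.

(** The condition on [2 ^+ (norm1 z).+1] makes the missing first terms at most half of the
    exponential; this half is the [ln 2]. *)
Lemma growth_lower (R : realType) d (xi : lattice d -> R) v (t : R) z :
  (forall z, 0 <= xi z) -> nonneg_pam_solution xi v -> 0 < t -> 0 < xi z ->
  2 ^+ (norm1 z).+1 <= expR (xi z * t / 2) ->
  ((xi z - 2 * d%:R - ((norm1 z)%:R * ln (xi z) + ln 2) / t)%:E <= growth_rate
      v t)%E.
Proof.
move=> xi0 vsol t0 xz hn; have [_ v0] := vsol; apply: growth_rate_ge => //.
apply: (@le_trans _ _ (v t z)%:E); last first.
  apply: esum_ge; exists [set z]; first by split => //; exact: finite_set1.
  by rewrite fsbig_set1.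
have xzt : 0 <= xi z * t by rewrite mulr_ge0// ltW.
have := sol_mass_ge xi0 vsol t0 xz; have := poisson_lower_tail (norm1 z) xzt.
set n := norm1 z; set S := \sum_(_ < _) _ => hS hv.
have e2 : expR (xi z * t) = expR (xi z * t / 2) * expR (xi z * t / 2).
  by rewrite -expRD; congr expR; field.
have hS2 : 2 * S <= expR (xi z * t).
  apply: (@le_trans _ _ (2 ^+ n.+1 * expR (xi z * t / 2))).
    by rewrite exprS -mulrA ler_wpM2l.
  by rewrite e2 ler_wpM2r ?expR_ge0.
rewrite lee_fin -(ler_pM2l (expR_gt0 (2 * d%:R * t))).
rewrite -(ler_pM2l (exprn_gt0 n xz)) -(ler_pM2l (ltr0n R 2)).
apply: (@le_trans _ _ (expR (xi z * t))); last by clear -hv hS2; lra.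
have -> : xi z ^+ n = expR (n%:R * ln (xi z)) by rewrite expRM_natl lnK.
have {1}-> : 2 = expR (ln 2) :> R by rewrite lnK// posrE.
rewrite -!expRD ler_expR le_eqVlt; apply/orP; left; apply/eqP.
by field; exact: lt0r_neq0.
Qed.

(** * Exponential potential *)

Lemma prod_one_minus_le (R : realType) (I : Type) (s : seq I) (v : I -> R) :
  (forall i, v i <= 1) ->
  \prod_(i <- s) (1 - v i) <= expR (- \sum_(i <- s) v i).
Proof.
move=> v1; rewrite -sumrN expR_sum; apply: ler_prod => i _.
by rewrite subr_ge0 v1 /= expR_ge1Dx.
Qed.

(** For [v <= b] the inverse [1 / (1 - v) = 1 + v / (1 - v)] is at most [exp (v / (1 - b))]. The
    loss [1 / (1 - b)] tends to 1 with [b] tending to 0. *)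
Lemma prod_one_minus_ge (R : realType) (I : Type) (s : seq I) (v : I -> R) (b :
    R) :
  b < 1 -> (forall i, 0 <= v i <= b) ->
  expR (- ((\sum_(i <- s) v i) / (1 - b))) <= \prod_(i <- s) (1 - v i).
Proof.
move=> b1 vb; rewrite mulr_suml -sumrN expR_sum; apply: ler_prod => i _.
have /andP[v0 v1] := vb i; rewrite expR_ge0 /=.
have b0 : 0 < 1 - b by rewrite subr_gt0.
have v1' : 0 < 1 - v i by lra.
rewrite expRN -[leRHS]invrK lef_pV2 ?posrE ?expR_gt0 ?invr_gt0//.
apply: le_trans (expR_ge1Dx _).
rewrite (_ : (1 - v i)^-1 = 1 + v i / (1 - v i)); last by field; exact: lt0r_neq0.
by rewrite lerD2l ler_wpM2l// lef_pV2 ?posrE//; lra.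
Qed.

Lemma growth_rate_leE (R : realType) d (v : R -> lattice d -> R) (t a : R) :
  0 < t -> (growth_rate v t <= a%:E)%E = (total_mass v t <= (expR (t * a))%:E)%E.
Proof.
move=> t0; apply/idP/idP; last exact: growth_rate_le.
rewrite /growth_rate lee_pdivrMl// -EFinM; case: (total_mass v t) => [x| |] /=.
- case: ifPn => [x0 _|]; first by rewrite lee_fin (le_trans x0) ?expR_ge0.
  rewrite -ltNge => x0; rewrite !lee_fin => h.
  by rewrite -[leLHS]lnK ?posrE// ler_expR.
- by rewrite leye_eq.
- by move=> _; exact: leNye.
Qed.

Lemma total_mass_leP (R : realType) d (v : R -> lattice d -> R) (t b : R) :
  (total_mass v t <= b%:E)%E <->
  forall Z : {fset lattice d}, \sum_(z <- Z) v t z <= b.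
Proof.
split => [h Z|h].
  rewrite -lee_fin -sumEFin; apply: le_trans h; apply: ereal_sup_ubound.
  exists [set` Z]; first by split.
  by rewrite fsbig_finite//= set_fsetK.
apply: ub_ereal_sup => _ [Z [Zfin _] <-].
by rewrite fsbig_finite//= sumEFin lee_fin.
Qed.

Lemma countType_bigcup_measurable disp (T : measurableType disp) (I : countType)
    (F : I -> set T) (D : set I) : (forall i, D i -> measurable (F i)) ->
  measurable (\bigcup_(i in D) F i).
Proof.
move=> mF; rewrite bigcup_mkcond; apply: countable_bigcupT_measurable.
  exact: countableP.
by move=> i; case: ifPn => //; rewrite inE; exact: mF.
Qed.

Lemma countType_bigcap_measurable disp (T : measurableType disp) (I : countType)
    (F : I -> set T) : (forall i, measurable (F i)) ->
  measurable (\bigcap_i F i).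
Proof.
move=> mF; rewrite -[X in measurable X]setCK setC_bigcap; apply: measurableC.
by apply: countType_bigcup_measurable => i _; exact: measurableC.
Qed.

Section probability.
Variables (R : realType) (d : nat) (disp : measure_display).
Variables (T : measurableType disp) (P : probability T R).
Variable xi : lattice d -> {RV P >-> R}.
Hypothesis xi_indep : mutually_independent xi.
Hypothesis xi_exp : forall (z : lattice d) (x : R), 0 <= x ->
  P [set w | xi z w > x] = (expR (- x))%:E.

Lemma measurable_RV_gt (X : {RV P >-> R}) y : measurable [set w | y < X w].
Proof.
rewrite (_ : [set w | _] = X @^-1` [set` `]y, +oo[]).
  exact: measurable_funPTI.
by apply/seteqP; split => w /=; rewrite in_itv /= andbT.
Qed.

Lemma measurable_RV_le (X : {RV P >-> R}) y : measurable [set w | X w <= y].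
Proof.
rewrite (_ : [set w | _] = ~` [set w | y < X w]).
  exact/measurableC/measurable_RV_gt.
by apply/seteqP; split => w /=; rewrite leNgt => /negP.
Qed.

Lemma prob_le z y : 0 <= y -> P [set w | xi z w <= y] = (1 - expR (- y))%:E.
Proof.
move=> y0; rewrite (_ : [set w | _] = ~` [set w | y < xi z w]).
  rewrite probability_setC ?xi_exp//; exact: measurable_RV_gt.
by apply/seteqP; split => w /=; rewrite leNgt => /negP.
Qed.

Definition below (J : {fset lattice d}) (y : lattice d -> R) : set T :=
  \bigcap_(z in [set` J]) [set w | xi z w <= y z].

Lemma measurable_below J y : measurable (below J y).
Proof.
by apply: fin_bigcap_measurable => // z _; exact: measurable_RV_le.
Qed.

Lemma prob_below (J : {fset lattice d}) (y : lattice d -> R) :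
  (forall z, 0 <= y z) ->
  P (below J y) = (\prod_(z <- J) (1 - expR (- y z)))%:E.
Proof.
move=> y0; have := @xi_indep J (fun z => [set` `]-oo, y z]]) _.
have pre z : xi z @^-1` [set` `]-oo, y z]] = [set w | xi z w <= y z].
  by apply/seteqP; split => w /=; rewrite in_itv.
rewrite (eq_bigcapr (fun i _ => pre i)) => ->; last by move=> z;
    exact: measurable_itv.
by rewrite -prodEFin; apply: eq_bigr => z _; rewrite pre prob_le.
Qed.

Lemma prob_pair y z a : y != z -> 0 <= a ->
  P ([set w | a < xi y w] `&` [set w | a < xi z w]) = (expR (- (2 * a)))%:E.
Proof.
move=> yz a0; have := @xi_indep [fset y; z]%fset (fun=> [set` `]a, +oo[]) _.
have pre i : xi i @^-1` [set` `]a, +oo[] = [set w | a < xi i w].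
  by apply/seteqP; split => w /=; rewrite in_itv /= andbT.
rewrite (eq_bigcapr (fun i _ => pre i)) (_ : \bigcap_(i in _) _ =
  [set w | a < xi y w] `&` [set w | a < xi z w]); last first.
  apply/seteqP; split => [w h|w [h1 h2] i /=].
    by split; apply: h; rewrite /= !inE eqxx ?orbT.
  by rewrite !inE => /orP[] /eqP ->.
move=> ->; last by move=> _; exact: measurable_itv.
rewrite big_fsetU1 ?inE//= big_seq_fset1 !pre !xi_exp// -EFinM -expRD.
by congr (expR _)%:E; ring.
Qed.

Lemma ae_xi_ge0 : {ae P, forall w, forall z, 0 <= xi z w}.
Proof.
have h z : {ae P, forall w, 0 <= xi z w}.
  exists [set w | xi z w <= 0]; split; first exact: measurable_RV_le.
    by rewrite prob_le// oppr0 expR0 subrr.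
  by move=> w /= /negP; rewrite -ltNge => /ltW.
pose Q (n : nat) w := if choice.unpickle n is Some z then 0 <= xi (z : lattice
    d) w else true.
have : {ae P, forall w, forall n, Q n w}.
  apply: ae_foralln => n; rewrite /Q.
  by case: choice.unpickle => [z|]; [exact: h|exact: aeW].
by apply: filterS => w hw z; have := hw (choice.pickle z);
    rewrite /Q choice.pickleK.
Qed.

(** [N] is only negligible, so it is replaced by a measurable null set that contains it. *)
Lemma prob_cover E A F S N : measurable E -> measurable A -> measurable F ->
  measurable S -> P.-negligible N -> E `<=` A `|` F `|` S `|` N ->
  (P E <= P A + P F + P S)%E.
Proof.
move=> mE mA mF mS [N' [mN' N'0 NN']] sub.
apply: (@le_trans _ _ (P (A `|` F `|` S `|` N'))).
  apply: le_measure; rewrite ?inE//; first by do !apply: measurableU.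
  by apply: (subset_trans sub); exact: setUS.
apply: (le_trans (measureU2 _ _ _)) => //; first by do !apply: measurableU.
rewrite [X in (_ + X <= _)%E]N'0 adde0; apply: (le_trans (measureU2 _ _ _)) =>
    //; first exact: measurableU.
by rewrite leeD2r//; exact: measureU2.
Qed.

(** The threshold leaves out [H]: off this event the sites outside the box satisfy the bound
    [H + c |z|] and, as [Lam <= H], none of them is bad. *)
Definition far_exceed (N : nat) (c : R) : set T :=
  \bigcup_(z in [set z | z \notin box d N]) [set w | c * (norm1 z)%:R < xi z w].

Lemma measurable_far_exceed N c : measurable (far_exceed N c).
Proof.
by apply: countType_bigcup_measurable => z _; exact: measurable_RV_gt.
Qed.

(** Half of the exponent gives the prefactor, the other half is summed over the box. *)
Lemma sum_far_le (N M : nat) (c : R) : 0 < c ->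
  \sum_(z <- box d M | z \notin box d N) expR (- (c * (norm1 z)%:R)) <=
  expR (- (c * N%:R / 2)) * (1 + 4 / c) ^+ d.
Proof.
move=> c0; have c20 : 0 < c / 2 by rewrite divr_gt0.
have := sum_box_exp_le d M c20.
rewrite (_ : 2 / (c / 2) = 4 / c); last by field; exact: lt0r_neq0.
move=> h; apply: (@le_trans _ _ (expR (- (c * N%:R / 2)) *
    \sum_(z <- box d M) expR (- (c / 2 * (norm1 z)%:R)))); last first.
  by rewrite ler_wpM2l ?expR_ge0.
rewrite mulr_sumr big_mkcond /=; apply: ler_sum => z _.
case: ifPn => [/notin_box zN|_]; last by rewrite mulr_ge0 ?expR_ge0.
rewrite -expRD ler_expR.
have : N%:R <= (norm1 z)%:R :> R by rewrite ler_nat ltnW.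
by move: N%:R (norm1 z)%:R => a b ab; nra.
Qed.

Lemma prob_far_exceed N (c : R) : 0 < c ->
  (P (far_exceed N c) <= (expR (- (c * N%:R / 2)) * (1 + 4 / c) ^+ d)%:E)%E.
Proof.
move=> c0; pose D M := [set z | z \in box d M /\ z \notin box d N].
pose F M := \bigcup_(z in D M) [set w | c * (norm1 z)%:R < xi z w].
have mF M : measurable (F M).
  by apply: countType_bigcup_measurable => z _; exact: measurable_RV_gt.
have FE : far_exceed N c = \bigcup_M F M.
  apply/seteqP; split => [w [z zN zw]|w [M _ [z [zM zN] zw]]].
    by exists (norm1 z) => //; exists z => //; split => //; exact: norm1_box.
  by exists z.
have mFE : measurable (\bigcup_M F M) by rewrite -FE;
    exact: measurable_far_exceed.
have nd : nondecreasing_seq F.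
  apply/nondecreasing_seqP => M; apply/subsetPset => w [z [zM zN] zw].
  by exists z => //; split => //; exact: box_subset zM.
have cv := nondecreasing_cvg_mu (mu := P) mF mFE nd.
rewrite FE; apply: (cvge_to_le cv); apply: nearW => M /=.
have Dfin : finite_set (D M).
  by apply: (sub_finite_set _ (finite_fset (box d M))) => z [].
have sub := @content_sub_fsum _ R T P _ (D M) (F M)
  (fun z => [set w | c * (norm1 z)%:R < xi z w]) Dfin
  (fun z _ => measurable_RV_gt (xi z) _) (mF M) (@subset_refl _ _).
apply: (le_trans sub) => {sub}.
rewrite (eq_fsbigr (fun z => (expR (- (c * (norm1 z)%:R)))%:E)); last first.
  by move=> z _; apply: xi_exp; rewrite mulr_ge0// ltW.
rewrite fsbig_finite//= sumEFin lee_fin.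
apply: le_trans (sum_far_le N M c0); rewrite [leRHS]big_fset_condE.
have -> : fset_set (D M) = [fset i in box d M | i \notin box d N]%fset.
  by apply/fsetP => z; rewrite in_fset_set// !inE /=; apply/idP/andP;
      rewrite ?inE.
exact: lexx.
Qed.

(** A pair is a site and a nonzero displacement, so pairs are counted by a product of boxes. *)
Definition close_pair (N K : nat) (a : R) : set T :=
  \bigcup_(p in [set p | p \in (box d N `*` box d K)%fset /\ p.2 != 0])
    ([set w | a < xi p.1 w] `&` [set w | a < xi (p.1 + p.2) w]).

Lemma measurable_close_pair N K a : measurable (close_pair N K a).
Proof.
apply: countType_bigcup_measurable => p _.
by apply: measurableI; exact: measurable_RV_gt.
Qed.

Lemma prob_close_pair N K (a : R) : 0 <= a ->
  (P (close_pair N K a) <=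
    (((2 * N + 1) ^ d * (2 * K + 1) ^ d)%:R * expR (- (2 * a)))%:E)%E.
Proof.
move=> a0; pose D := [set p | p \in (box d N `*` box d K)%fset /\ p.2 != 0].
have Dfin : finite_set D.
  by apply: (sub_finite_set _ (finite_fset (box d N `*` box d K)%fset)) => z [].
have sub := @content_sub_fsum _ R T P _ D (close_pair N K a)
  (fun p => [set w | a < xi p.1 w] `&` [set w | a < xi (p.1 + p.2) w]) Dfin
  (fun p _ => measurableI _ _ (measurable_RV_gt (xi p.1) a)
    (measurable_RV_gt (xi (p.1 + p.2)) a))
  (measurable_close_pair N K a) (@subset_refl _ _).
apply: (le_trans sub) => {sub}.
rewrite (eq_fsbigr (fun=> (expR (- (2 * a)))%:E)); last first.
  move=> p; rewrite inE => -[_ p2]; apply: prob_pair => //.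
  by apply: contra_neq p2 => pE; apply: (addrI p.1); rewrite addr0.
rewrite fsbig_finite//= sumEFin lee_fin big_const_seq iter_addr_0 count_predT.
rewrite -[leLHS]mulr_natl ler_wpM2r ?expR_ge0// ler_nat.
apply: (@leq_trans (size [seq (x, y) | x <- box d N, y <- box d K])).
  apply: uniq_leq_size; first exact: fset_uniq.
  move=> [x y]; rewrite in_fset_set// inE => -[+ _];
      rewrite in_fsetM => /andP[xN yK].
  by apply/allpairsP; exists (x, y).
by rewrite size_allpairs leq_mul ?card_box.
Qed.

End probability.

(** * Probability bounds at a fixed time *)

Section fixed_time.
Variables (R : realType) (d : nat) (disp : measure_display).
Variables (T : measurableType disp) (P : probability T R).
Variable xi : lattice d -> {RV P >-> R}.
Hypothesis xi_indep : mutually_independent xi.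
Hypothesis xi_exp : forall (z : lattice d) (x : R), 0 <= x ->
  P [set w | xi z w > x] = (expR (- x))%:E.
Variable u : R -> lattice d -> {RV P >-> R}.
Hypothesis u_sol : {ae P, forall w : T,
  unique_nonneg_pam_solution (fun z => xi z w) (fun t z => u t z w)}.

Definition growth_event (t a : R) : set T :=
  [set w | (growth_rate (fun s z => u s z w) t <= a%:E)%E].

Lemma measurable_growth_event t a : 0 < t -> measurable (growth_event t a).
Proof.
move=> t0; pose S (Z : {fset lattice d}) w := \sum_(z <- Z) u t z w.
rewrite (_ : growth_event t a = \bigcap_Z [set w | S Z w <= expR (t * a)]).
  apply: countType_bigcap_measurable => Z.
  have mS : measurable_fun setT (S Z).
    by apply: measurable_sum => z; exact: measurable_funPT.
  rewrite (_ : [set w | _] = setT `&` S Z @^-1` [set` `]-oo, expR (t * a)]]).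
    exact: mS.
  by rewrite setTI; apply/seteqP; split => w /=; rewrite in_itv.
apply/seteqP; split => w; rewrite /growth_event /= growth_rate_leE//.
  by move=> /total_mass_leP h Z _; exact: h.
by move=> h; apply/total_mass_leP => Z; exact: h.
Qed.

Definition exceptional : set T := ~` [set w |
  unique_nonneg_pam_solution (fun z => xi z w) (fun t z => u t z w) /\
  forall z, 0 <= xi z w].

Lemma negligible_exceptional : P.-negligible exceptional.
Proof.
apply: negligibleS (negligibleU u_sol (ae_xi_ge0 xi_exp)) => w /=.
by move=> /not_andP[h|h]; [left|right].
Qed.

(** A single site of the box above its threshold already forces growth beyond [a], so the event lies
    in [below] up to a null set. *)
Lemma prob_growth_le (t a : R) (N : nat) (y : lattice d -> R) :
  0 < t -> (forall z, 0 <= y z) ->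
  (forall z x, z \in box d N -> y z < x ->
    2 ^+ (norm1 z).+1 <= expR (x * t / 2) /\
    a < x - 2 * d%:R - ((norm1 z)%:R * ln x + ln 2) / t) ->
  (P (growth_event t a) <= (\prod_(z <- box d N) (1 - expR (- y z)))%:E)%E.
Proof.
move=> t0 y0 hy; rewrite -(prob_below xi_indep xi_exp _ y0).
have mA := measurable_growth_event a t0.
have mB := measurable_below xi (box d N) y.
have := @prob_cover _ _ _ P (growth_event t a) (below xi (box d N) y) set0 set0
  exceptional mA mB measurable0 measurable0 negligible_exceptional.
rewrite measure0 !adde0; apply => w wA.
have [wx|wx] := pselect (exceptional w); [by right|left; left; left].
move: wx; rewrite /exceptional /= => /contrapT [[sol _] xi0] z /= zN.
rewrite leNgt; apply/negP => yz.
have [h1 h2] := hy z _ zN yz.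
have xz : 0 < xi z w by exact: le_lt_trans (y0 z) yz.
have := growth_lower xi0 sol t0 xz h1; rewrite leNgt => /negP; apply.
by apply: le_lt_trans wA _; rewrite lte_fin.
Qed.

(** On [below], and off the far and close events, the level construction applies; the two error
    terms are the probabilities of these events. *)
Lemma prob_growth_ge (t a theta H Lam eps c l C : R) (m k N : nat) :
  0 < t -> 0 <= theta <= 1 -> 1 <= theta * m%:R -> (0 < k)%N ->
  0 <= Lam <= H -> 0 < eps -> 0 < c -> 0 <= l -> 1 <= C -> C <= expR l ->
  4 * d%:R <= eps * C -> 2 * d%:R * expR l + 2 * d%:R <= Lam ->
  c * t * k%:R + 2 * k%:R * d%:R + 1 <= l * ((1 - theta) * k%:R - 4) ->
  2 * C * expR (l * ((1 - theta) * k%:R + 2)) * expR ((H + eps) * t) <=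
    expR (t * (a + 2 * d%:R)) ->
  ((\prod_(z <- box d N) (1 - expR (- (H + c * (norm1 z)%:R))))%:E <=
    P (growth_event t a) +
    (expR (- (c * N%:R / 2)) * (1 + 4 / c) ^+ d)%:E +
    (((2 * N + 1) ^ d * (2 * (2 * m + 1) + 1) ^ d)%:R *
       expR (- (2 * (H - Lam))))%:E)%E.
Proof.
move=> t0 th01 thm k0 /andP[Lam0 LamH] eps0 c0 l0 C1 Cl Ceps Laml hl ha.
have H0 : 0 <= H by exact: le_trans LamH.
have y0 (z : lattice d) : 0 <= H + c * (norm1 z)%:R by rewrite addr_ge0
    ?mulr_ge0// ltW.
rewrite -(prob_below xi_indep xi_exp _ y0).
have aLam0 : 0 <= H - Lam by rewrite subr_ge0.
have hF := prob_far_exceed xi_exp N c0.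
have hS := prob_close_pair xi_indep xi_exp N (2 * m + 1) aLam0.
apply: le_trans (leeD (leeD2l _ hF) hS).
apply: (@prob_cover _ _ _ _ _ _ _ _ exceptional).
- exact: measurable_below.
- exact: measurable_growth_event.
- exact: measurable_far_exceed.
- exact: measurable_close_pair.
- exact: negligible_exceptional.
move=> w wE.
have [wx|wx] := pselect (exceptional w); [by right|left].
have [wS|wS] := pselect (close_pair xi N (2 * m + 1) (H - Lam) w);
    [by right|left].
have [wF|wF] := pselect (far_exceed xi N c w); [by right|left].
move: wx; rewrite /exceptional /= => /contrapT [sol xi0].
have xi_far z : z \notin box d N -> xi z w <= c * (norm1 z)%:R.
  by move=> zN; rewrite leNgt; apply/negP => h; apply: wF; exists z.
have xi_le z : xi z w <= H + c * (norm1 z)%:R.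
  have [zN|zN] := boolP (z \in box d N); first exact: wE.
  by apply: le_trans (xi_far z zN) _; rewrite lerDr.
have bad_in b : bad_site (fun z => xi z w) H Lam c b -> b \in box d N.
  move=> bb; rewrite -[_ \in _]negbK; apply/negP => bN; move: bb.
  by rewrite /bad_site ltNge => /negP; apply; apply: le_trans (xi_far b bN) _;
      rewrite lerDr.
have bad_gt b : bad_site (fun z => xi z w) H Lam c b -> H - Lam < xi b w.
  by rewrite /bad_site; apply: le_lt_trans; rewrite lerDl mulr_ge0// ltW.
have sep b b' : bad_site (fun z => xi z w) H Lam c b ->
    bad_site (fun z => xi z w) H Lam c b' -> b != b' -> (2 * m + 1 < dist1 b
        b')%N.
  move=> hb hb' bb'; rewrite ltnNge; apply/negP => near; apply: wS.
  exists (b', b - b'); rewrite /=; last first.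
    by split; [exact: bad_gt|rewrite subrKC; exact: bad_gt].
  by split; rewrite ?subr_eq0// in_fsetM /= bad_in//= norm1_box.
have hB := total_wpart_le xi0 th01 thm k0 H0 eps0 (ltW c0) l0 C1 Cl Ceps Laml
    xi_le sep.
have := @growth_upper R d (fun z => xi z w) (fun s z => u s z w) t (a + 2 *
    d%:R) xi0 sol t0.
rewrite /growth_event /= addrK; apply => Z n.
by apply: le_trans (hB Z n t (ltW t0) hl) ha.
Qed.

End fixed_time.

(** * Asymptotics *)

Lemma expR_ge_mul (R : realType) (M x : R) : 0 <= x -> 2 * M <= x -> M * x <=
    expR x.
Proof.
move=> x0 xM; have := expR_ge1Dxn 1 x0; rewrite (_ : 2`! = 2%N)//.
by apply: le_trans; nra.
Qed.

Lemma ln_le_chord (R : realType) (y v : R) : 0 < y -> 0 < v ->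
  ln v <= ln y + (v - y) / y.
Proof.
move=> y0 v0; have := @le_ln1Dx R ((v - y) / y).
have -> : 1 + (v - y) / y = v / y by field; exact: lt0r_neq0.
rewrite ln_div ?posrE//; move=> h; rewrite -lerBlDl; apply: h.
by rewrite mulrBl divff ?lt0r_neq0//; have := divr_gt0 v0 y0; lra.
Qed.

(** * Parameters for the upper bound on the distribution function *)

Section upper.
Variables (R : realType) (d : nat) (x delta : R).
Hypothesis d_gt0 : (0 < d)%N.
Hypothesis delta01 : 0 < delta < 1.

(** At the threshold [y], the slope [(1 + delta) L / t] pays the travel cost and [delta] pays
    [ln 2 / t]. A larger [v] only helps: by the tangent of [ln] at [y], the cost grows at rate at
    most [(n / t) / y <= d / y < 1]. *)
Lemma upper_site_cond (t L a y : R) (n : nat) (v : R) :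
  1 <= t -> n%:R <= d%:R * t -> 2 * (d%:R + 1) <= a + 2 * d%:R + delta ->
  y = a + 2 * d%:R + delta + (1 + delta) * L / t * n%:R ->
  0 <= L -> ln y <= (1 + delta) * L -> 1 < delta * t -> y < v ->
  2 ^+ n.+1 <= expR (v * t / 2) /\
  a < v - 2 * d%:R - (n%:R * ln v + ln 2) / t.
Proof.
move=> t1 nd H2 yE L0 lny dt yv; have /andP[dl0 dl1] := delta01.
have t0 : 0 < t by lra.
have d0 : 1 <= d%:R :> R by rewrite ler1n.
have c0 : 0 <= (1 + delta) * L / t * n%:R.
  by rewrite !mulr_ge0 ?invr_ge0//; lra.
have y2 : 2 * (d%:R + 1) <= y by lra.
have y0 : 0 < y by lra.
have v0 : 0 < v by lra.
have ln2 : ln 2 <= 1 :> R.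
  have := @le_ln1Dx R 1; rewrite (_ : 1 + 1 = 2)//; apply; lra.
have ln20 : 0 <= ln 2 :> R by rewrite ln_ge0// ler1n.
split.
  have -> : 2 ^+ n.+1 = expR (n.+1%:R * ln 2) :> R.
    by rewrite expRM_natl lnK// posrE.
  rewrite ler_expR -natr1; apply: (@le_trans _ _ (n%:R + 1)).
    by rewrite ler_piMr.
  nra.
pose r := n%:R / t; have r0 : 0 <= r by rewrite divr_ge0// ltW.
have rd : r <= d%:R by rewrite /r ler_pdivrMr.
have -> : (n%:R * ln v + ln 2) / t = r * ln v + ln 2 / t.
  by rewrite /r; field; exact: lt0r_neq0.
have h2 : ln 2 / t < delta by rewrite ltr_pdivrMr//; lra.
have h3 : r * ln v <= r * ln y + (v - y).
  apply: (@le_trans _ _ (r * (ln y + (v - y) / y))).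
    by rewrite ler_wpM2l// ln_le_chord.
  rewrite mulrDr lerD2l mulrCA ler_piMr ?subr_ge0 1?ltW//.
  by rewrite ltr_pdivrMr//; lra.
have h4 : r * ln y <= r * ((1 + delta) * L) by rewrite ler_wpM2l.
have h5 : (1 + delta) * L / t * n%:R = r * ((1 + delta) * L).
  by rewrite /r; field; exact: lt0r_neq0.
lra.
Qed.

(** Radius [t] is enough: [c N] is then at least about [L], so the box misses only a relative part
    [exp (- L)] of each one-dimensional sum. *)
Lemma upper_box (t L : R) : 0 < L -> 0 < t ->
  expR (- L) <= delta / 4 -> L / t <= delta / 4 ->
  (2 * (1 - delta) / (1 + delta)) ^+ d <= (L / t) ^+ d *
    \sum_(z <- box d (Num.truncn t)) expR (- ((1 + delta) * L / t * (norm1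
        z)%:R)).
Proof.
have /andP[dl0 dl1] := delta01 => L0 t0 eL Lt.
have d10 : 0 < 1 + delta by lra.
set c := (1 + delta) * L / t.
have c0 : 0 < c by rewrite divr_gt0 ?mulr_gt0.
set N := Num.truncn t.
have tN : t <= N.+1%:R by apply/ltW; rewrite truncnS_gt.
have cN : L <= c * N.+1%:R.
  apply: (@le_trans _ _ (c * t)); last by rewrite ler_wpM2l// ltW.
  by rewrite /c divfK ?lt0r_neq0// ler_peMl ?lerDl// ltW.
have eN : expR (- (c * N.+1%:R)) <= delta / 4.
  by apply: le_trans eL; rewrite ler_expR lerN2.
have e0 := expR_gt0 (- (c * N.+1%:R)).
have := sum_box_exp_ge d (N := N) c0; move: eN e0.
move: (expR (- (c * N.+1%:R))) => E eN e0.
have cE : 2 * (1 - E) / c = 2 * (1 - E) / (1 + delta) * (t / L).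
  by rewrite /c; field; rewrite !lt0r_neq0.
have main : 2 * (1 - delta) / (1 + delta) <= L / t * (2 * (1 - E) / c - 1).
  rewrite cE (_ : L / t * _ = 2 * (1 - E) / (1 + delta) - L / t); last first.
    by field; rewrite !lt0r_neq0.
  rewrite lerBrDr; apply: le_trans (lerD (lexx _) Lt) _.
  rewrite ler_pdivlMr// mulrDl divfK ?lt0r_neq0//.
  have d2 : delta * delta <= delta by rewrite ler_piMr// ltW.
  lra.
have pos : 0 < 2 * (1 - delta) / (1 + delta).
  by rewrite divr_gt0 ?mulr_gt0// subr_gt0.
have Q1 : 1 <= 2 * (1 - E) / c.
  have : 0 < L / t * (2 * (1 - E) / c - 1) by exact: lt_le_trans main.
  by rewrite pmulr_rgt0 ?divr_gt0// subr_gt0 => /ltW.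
move=> /(_ Q1) hs.
apply: (@le_trans _ _ ((L / t) ^+ d * (2 * (1 - E) / c - 1) ^+ d)); last first.
  by rewrite ler_wpM2l// exprn_ge0// divr_ge0// ltW.
rewrite -exprMn lerXn2r ?nnegrE//; first exact: ltW.
by apply: le_trans main; exact: ltW.
Qed.

Lemma upper_regime (L s t a h K : R) :
  s = expR L -> t = expR s -> a = x + d%:R * s - d%:R * ln L ->
  h = a + 2 * d%:R + delta ->
  K = `|x| + 2 * d%:R + delta + d%:R + (1 + delta) * d%:R ->
  4 <= L -> 4 / delta <= L -> ln K / delta <= L -> 2 * (d%:R + 1) + `|x| <= L ->
  [/\ 1 <= t, 0 <= L, 2 * (d%:R + 1) <= h, 1 < delta * t &
     (forall n : nat, n%:R <= d%:R * t ->
        ln (h + (1 + delta) * L / t * n%:R) <= (1 + delta) * L)] /\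
  expR (- L) <= delta / 4 /\ L / t <= delta / 4.
Proof.
have /andP[dl0 dl1] := delta01.
have d1 : 1 <= d%:R :> R by rewrite ler1n.
move=> sE tE aE hE KE L4 Ld LK Lx.
have L0 : 0 < L by lra.
have sL : 2 * L <= s by rewrite sE; apply: expR_ge_mul; lra.
have ts : L * s <= t by rewrite tE; apply: expR_ge_mul; lra.
have s1 : 1 <= s by lra.
have s0 : 0 < s by lra.
have Ls : L <= s by lra.
have lnL : ln L <= L by rewrite ltW// ln_sublinear.
have lnL0 : 0 <= ln L by rewrite ln_ge0//; lra.
have t0 : 0 < t by rewrite tE expR_gt0.
have dL : 4 <= delta * L by move: Ld; rewrite ler_pdivrMr// mulrC.
have Lt4 : 4 * L <= delta * t.
  apply: (@le_trans _ _ (delta * (L * s))); last by rewrite ler_pM2l.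
  by rewrite mulrA ler_pM// ltW.
have K1 : 1 <= K.
  rewrite KE; have : 0 <= `|x| by []; have : 0 <= (1 + delta) * d%:R by rewrite
      mulr_ge0//; lra.
  lra.
split; last split; first split; [|exact: ltW| |by lra| | |].
- have : 4 * s <= L * s by rewrite ler_pM2r.
  lra.
- have := ler_norm (- x); rewrite normrN => nx1.
  have : d%:R * L <= d%:R * (s - ln L) by rewrite ler_wpM2l//; lra.
  have : L <= d%:R * L by rewrite ler_peMl// ltW.
  by rewrite hE aE mulrBr; lra.
- move=> n nt; pose y := (1 + delta) * L / t * n%:R.
  have p0 : 0 <= (1 + delta) * L by rewrite mulr_ge0// ltW// addr_gt0.
  have y0 : 0 <= y by rewrite mulr_ge0// divr_ge0// ltW.
  have y1 : y <= (1 + delta) * d%:R * s.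
    apply: (@le_trans _ _ ((1 + delta) * L * d%:R)).
      by rewrite /y -mulrA ler_wpM2l// mulrC ler_pdivrMr.
    by rewrite mulrAC ler_wpM2l// mulr_ge0// ltW// addr_gt0.
  (* With [s = exp L] this gives [ln (h + y) <= ln K + L], and [ln K] fits into [delta L]. *)
  have hK : h + y <= K * s.
    have q0 := ler_norm x.
    have q1 : `|x| <= `|x| * s by rewrite ler_peMr.
    have q2 : 2 * d%:R <= 2 * d%:R * s by rewrite ler_peMr// mulr_ge0.
    have q3 : delta <= delta * s by rewrite ler_peMr// ltW.
    have q5 : 0 <= d%:R * ln L by rewrite mulr_ge0.
    by rewrite hE aE KE; clearbody y; lra.
  have K0 : 0 < K by exact: lt_le_trans K1.
  have h0 : 0 < h + y.
    rewrite ltr_wpDr// hE aE; have := ler_norm (- x); rewrite normrN => nx1.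
    have : L <= d%:R * (s - ln L).
      by apply: (@le_trans _ _ (s - ln L)); [lra|rewrite ler_peMl//; lra].
    by rewrite mulrBr; lra.
  apply: (@le_trans _ _ (ln (K * s))); first by rewrite ler_ln ?posrE ?mulr_gt0.
  rewrite lnM ?posrE// sE expRK.
  by move: LK; rewrite ler_pdivrMr// mulrDl mul1r addrC lerD2l mulrC.
- rewrite expRN -[leRHS]invrK lef_pV2 ?posrE ?expR_gt0 ?invr_gt0 ?divr_gt0//.
  by rewrite invf_div -sE (le_trans Ld).
- by rewrite ler_pdivrMr// mulrAC ler_pdivlMr// mulrC.
Qed.

Lemma upper_near : \forall L \near +oo,
  let s := expR L in let t := expR s in
  let a := x + d%:R * s - d%:R * ln L in
  let h := a + 2 * d%:R + delta in
  [/\ 1 <= t, 0 <= L, 2 * (d%:R + 1) <= h, 1 < delta * t &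
     (forall n : nat, n%:R <= d%:R * t ->
        ln (h + (1 + delta) * L / t * n%:R) <= (1 + delta) * L)] /\
  expR (- x - 2 * d%:R - delta) * (2 * (1 - delta) / (1 + delta)) ^+ d <=
  expR (- h) *
   \sum_(z <- box d (Num.truncn t)) expR (- ((1 + delta) * L / t * (norm1 z)%:R)).
Proof.
near=> L => s t a h.
have L4 : 4 <= L by near: L; apply: nbhs_pinfty_ge; exact: num_real.
have Ld : 4 / delta <= L by near: L; apply: nbhs_pinfty_ge; exact: num_real.
have LK : ln (`|x| + 2 * d%:R + delta + d%:R + (1 + delta) * d%:R) / delta <= L.
  by near: L; apply: nbhs_pinfty_ge; exact: num_real.
have Lx : 2 * (d%:R + 1) + `|x| <= L by near: L; apply: nbhs_pinfty_ge;
    exact: num_real.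
have L0 : 0 < L by exact: lt_le_trans L4.
have t0 : 0 < t by exact: expR_gt0.
have [cond [eL Lt]] := @upper_regime L s t a h _ (erefl _) (erefl _) (erefl _)
  (erefl _) (erefl _) L4 Ld LK Lx.
split => //.
(* Here the normalisation of the theorem enters: [d ln t - d ln ln ln t] contributes [(L / t) ^ d],
   which cancels the order of the sum. *)
have -> : expR (- h) = expR (- x - 2 * d%:R - delta) * (L / t) ^+ d.
  have -> : L / t = expR (ln L - s) by rewrite expRB lnK ?posrE.
  by rewrite -expRM_natl -expRD /h /a; congr expR; ring.
by rewrite -[leRHS]mulrA ler_wpM2l ?expR_ge0//; exact: upper_box.
Unshelve. all: by end_near.
Qed.

End upper.

Lemma expRN_le_inv (R : realType) (x : R) : 0 < x -> expR (- x) <= x^-1.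
Proof.
move=> x0; rewrite expRN lef_pV2 ?posrE ?expR_gt0//.
by apply: ltW; apply: le_lt_trans (expR_gt1Dx _); rewrite ?lt0r_neq0// lerDr.
Qed.

(** * Parameters for the lower bound on the distribution function *)

Section lower.
Variables (R : realType) (d : nat) (x delta eta : R).
Hypothesis d_gt0 : (0 < d)%N.

(** With radius at least [t s], the factor [exp (- c N / 2)] is at most [exp (- (d + 1) s)]; it
    beats [(9 t) ^ d = 9 ^ d exp (d s)] and leaves [exp (- s)]. *)
Lemma far_small (t s L c : R) (N : nat) : 0 < delta <= 2^-1 -> 0 < eta ->
  t = expR s -> 1 <= t -> 1 <= s -> 4 * (d%:R + 1) <= L / 2 -> 9 ^+ d / eta <=
      s ->
  c = (1 - delta) * L / t -> t * s <= N%:R ->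
  expR (- (c * N%:R / 2)) * (1 + 4 / c) ^+ d <= eta.
Proof.
move=> /andP[dl0 dl1] eta0 tE t1 s1 Ld s9 cE Nts.
have t0 : 0 < t by lra.
have d0 : 0 <= d%:R :> R by [].
have dl2 : 0 < 1 - delta by lra.
have L0 : 0 < L by lra.
have L8 : 8 <= L by lra.
have c0 : 0 < c by rewrite cE divr_gt0 ?mulr_gt0.
have h1 : 1 + 4 / c <= 9 * t.
  have -> : 4 / c = 4 / ((1 - delta) * L) * t by rewrite cE; field;
      rewrite !lt0r_neq0.
  have : 4 / ((1 - delta) * L) <= 8 by rewrite ler_pdivrMr ?mulr_gt0//; nra.
  by move: (4 / _) => q hq; nra.
have h2 : (d%:R + 1) * s <= c * N%:R / 2.
  have : c * (t * s) <= c * N%:R by rewrite ler_wpM2l// ltW.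
  have -> : c * (t * s) = (1 - delta) * L * s by rewrite cE; field;
      rewrite lt0r_neq0.
  have : (d%:R + 1) * s <= (1 - delta) * L * s / 2.
    rewrite mulrAC ler_wpM2r//; [lra|]; nra.
  lra.
apply: (@le_trans _ _ (expR (- ((d%:R + 1) * s)) * (9 * t) ^+ d)).
  rewrite ler_pM ?expR_ge0 ?exprn_ge0 ?ler_expR ?lerN2//.
    by rewrite addr_ge0// divr_ge0// ltW.
  rewrite lerXn2r ?nnegrE// ?mulr_ge0 ?(ltW t0)//.
  by rewrite addr_ge0// divr_ge0// ltW.
rewrite exprMn tE -expRM_natl mulrCA -expRD.
have -> : - ((d%:R + 1) * s) + d%:R * s = - s by ring.
have s0 : 0 < s by lra.
apply: (@le_trans _ _ (9 ^+ d * s^-1)); first by rewrite ler_wpM2l ?exprn_ge0//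
    expRN_le_inv.
by rewrite ler_pdivrMr// mulrC -ler_pdivrMr.
Qed.

(** The depth [H / 4] gives [exp (- 3 H / 2)], with [H] near [d s], against about [exp (d s)] pairs.
    The terms in [L] are absorbed by [10 L <= s]. *)
Lemma close_small (t s L H : R) (N M : nat) : 0 < eta ->
  t = expR s -> s = expR L -> 1 <= t -> 1 <= s -> 0 <= L -> 10 * L <= s ->
  4 * ((5 * M%:R) ^+ d * expR (3 / 2 * `|x|)) / eta <= s ->
  d%:R * (s - L) - `|x| <= H -> N%:R <= t * s + 1 ->
  ((2 * N + 1) ^ d * M ^ d)%:R * expR (- (2 * (H - H / 4))) <= eta.
Proof.
move=> eta0 tE sE t1 s1 L0 sL sM hH hN.
have s0 : 0 < s by lra.
have d1 : 1 <= d%:R :> R by rewrite ler1n.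
have ts1 : 1 <= t * s by nra.
have hN5 : (2 * N + 1)%:R <= 5 * (t * s) :> R by rewrite natrD natrM; lra.
have h1 : ((2 * N + 1) ^ d * M ^ d)%:R <= (5 * M%:R) ^+ d * expR (d%:R * (s + L)).
  rewrite natrM !natrX -exprMn expRM_natl -exprMn lerXn2r ?nnegrE ?mulr_ge0
      ?expR_ge0//.
  rewrite expRD -tE -sE mulrAC ler_wpM2r//; lra.
have h2 : expR (- (2 * (H - H / 4))) <=
    expR (3 / 2 * `|x|) * expR (- (3 / 2 * (d%:R * (s - L)))).
  by rewrite -expRD ler_expR; lra.
apply: (@le_trans _ _ ((5 * M%:R) ^+ d * expR (d%:R * (s + L)) *
   (expR (3 / 2 * `|x|) * expR (- (3 / 2 * (d%:R * (s - L))))))).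
  by rewrite ler_pM ?expR_ge0.
set B := (5 * M%:R) ^+ d * expR (3 / 2 * `|x|) in sM *.
have B0 : 0 <= B by rewrite mulr_ge0 ?expR_ge0 ?exprn_ge0 ?mulr_ge0.
rewrite [leLHS](_ : _ = B * expR (d%:R * (s + L) - 3 / 2 * (d%:R * (s - L))));
    last first.
  by rewrite /B expRD; ring.
have h3 : d%:R * (s + L) - 3 / 2 * (d%:R * (s - L)) <= - (s / 4).
  have : 0 <= d%:R * (s - 10 * L) by rewrite mulr_ge0//; lra.
  have : s <= d%:R * s by rewrite ler_peMl// ltW.
  lra.
apply: (@le_trans _ _ (B * (s / 4)^-1)).
  rewrite ler_wpM2l//; apply: (@le_trans _ _ (expR (- (s / 4)))).
    by rewrite ler_expR.
  by apply: expRN_le_inv; lra.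
rewrite invf_div mulrA ler_pdivrMr//.
by move: sM; rewrite ler_pdivrMr// ; lra.
Qed.

(** The factor [1 + delta] in the exponent bounds [1 / (1 - b)] for [b = exp (- H) <= delta / 2]. *)
Lemma product_large (t L H c : R) (N : nat) : 0 < delta <= 2^-1 ->
  0 < t -> 0 < L -> L / t <= delta -> 2 / delta <= H -> c = (1 - delta) * L / t ->
  expR (- H) = expR (- x - 2 * d%:R + 2 * delta) * (L / t) ^+ d ->
  expR (- (expR (- x - 2 * d%:R + 2 * delta) *
           (2 * (1 + delta) / (1 - delta)) ^+ d * (1 + delta))) <=
  \prod_(z <- box d N) (1 - expR (- (H + c * (norm1 z)%:R))).
Proof.
move=> /andP[dl0 dl1] t0 L0 Lt H2 cE EH.
have dl2 : 0 < 1 - delta by lra.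
have c0 : 0 < c by rewrite cE divr_gt0 ?mulr_gt0.
have H0 : 0 < H by apply: lt_le_trans H2; rewrite divr_gt0.
have b : expR (- H) <= delta / 2.
  apply: (le_trans (expRN_le_inv H0)); rewrite -[leRHS]invrK invf_div lef_pV2
      ?posrE//.
  by rewrite divr_gt0.
have b1 : expR (- H) < 1 by lra.
have b0 := expR_ge0 (- H).
apply: (le_trans _ (prod_one_minus_ge _ b1 _)); last first.
  move=> z; rewrite expR_ge0 /= ler_expR lerN2 lerDl.
  by rewrite mulr_ge0// ltW.
rewrite ler_expR lerN2.
under eq_bigr do rewrite opprD expRD.
rewrite -mulr_sumr {1}EH; set E := expR (- x - _ + _).
have E0 : 0 <= E by exact: expR_ge0.
rewrite -[E * _ * _]mulrA -[leLHS]mulrA -[leRHS]mulrA ler_wpM2l// ler_pM//.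
- by rewrite mulr_ge0 ?exprn_ge0 ?divr_ge0 ?(ltW L0) ?(ltW t0)//;
    apply: sumr_ge0 => z _; exact: expR_ge0.
- by rewrite invr_ge0; lra.
- apply: (@le_trans _ _ ((L / t) ^+ d * (1 + 2 / c) ^+ d)).
    rewrite ler_wpM2l ?exprn_ge0 ?divr_ge0 ?(ltW L0) ?(ltW t0)//.
    exact: sum_box_exp_le.
  have q0 : 0 <= L / t * (1 + 2 / c).
    by rewrite mulr_ge0 ?addr_ge0 ?divr_ge0// ltW.
  have q1 : L / t * (1 + 2 / c) <= 2 * (1 + delta) / (1 - delta).
    rewrite (_ : L / t * _ = L / t + 2 / (1 - delta)); last first.
      by rewrite cE; field; rewrite !lt0r_neq0.
    rewrite ler_pdivlMr// mulrDl divfK ?lt0r_neq0//.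
    have : L / t * (1 - delta) <= delta * 1.
      by rewrite ler_pM ?divr_ge0//; lra.
    lra.
  by rewrite -exprMn lerXn2r ?nnegrE// (le_trans q0).
- rewrite -[leLHS]mul1r ler_pdivrMr; [nra|lra].
Qed.

End lower.

(** The choice [expR l = H / (16 d)] makes [2 d expR l = H / 8], so [Lam = H / 4] suffices, while
    [l] stays within a constant of [L]. The slack between [(1 - delta) L] and [(1 - delta / 4) l]
    absorbs the constants of each level. The remaining prefactor is [exp (O(s))], below
    [exp (delta t)]; hence the two [delta] in the final exponent, the other one being the rate
    excess. *)
Lemma lower_params (R : realType) (d k : nat) (delta L s t H C K c : R) :
  (0 < d)%N -> 0 < delta <= 2^-1 -> 32 / delta <= k%:R -> 1 <= t -> 1 <= s ->
  0 <= L -> s = expR L -> s / 2 <= H -> H <= K * s -> 0 <= K ->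
  C = 4 * d%:R / delta -> 128 * d%:R * d%:R / delta <= s ->
  2 * (ln (32 * d%:R) + 2 * d%:R + 1) / delta <= L ->
  (ln (2 * C) + (k%:R + 2) * K) * s <= delta * t ->
  c * t = (1 - delta) * L ->
  let l := ln (H / (16 * d%:R)) in
  [/\ 0 <= l, 1 <= C, C <= expR l, 2 * d%:R * expR l + 2 * d%:R <= H / 4 &
     c * t * k%:R + 2 * k%:R * d%:R + 1 <= l * ((1 - delta / 8) * k%:R - 4)] /\
  2 * C * expR (l * ((1 - delta / 8) * k%:R + 2)) * expR ((H + delta) * t) <=
    expR (t * (H + 2 * delta)).
Proof.
move=> d_gt0 /andP[dl0 dl1] hk t1 s1 L0 sE sH HK K0 CE s128 L32 hs ct l.
have d1 : 1 <= d%:R :> R by rewrite ler1n.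
have d0 : 0 < d%:R :> R by lra.
have s0 : 0 < s by lra.
have dd : 128 * d%:R * d%:R <= s * delta by rewrite -ler_pdivrMr.
have s64 : 256 * d%:R <= s.
  have : s * delta <= s / 2 by rewrite ler_pM2l.
  nra.
have H0 : 0 < H by lra.
have el : expR l = H / (16 * d%:R) by rewrite lnK// posrE divr_gt0// mulr_gt0.
have l1 : 0 <= l.
  by rewrite /l ln_ge0// ler_pdivlMr ?mulr_gt0//; lra.
have C1 : 1 <= C by rewrite CE ler_pdivlMr//; lra.
have lL : L - ln (32 * d%:R) <= l.
  rewrite -[L]expRK -sE -ln_div ?posrE ?mulr_gt0// /l ler_ln ?posrE ?divr_gt0
      ?mulr_gt0//.
  rewrite ler_pdivrMr ?mulr_gt0//.
  have -> : H / (16 * d%:R) * (32 * d%:R) = 2 * H by field; exact: lt0r_neq0.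
  lra.
have K1 : 0 <= ln (32 * d%:R) :> R by rewrite ln_ge0//; lra.
have hL : 2 * (ln (32 * d%:R) + 2 * d%:R + 1) <= L * delta by rewrite
    -ler_pdivrMr.
have k32 : 32 <= k%:R * delta by rewrite -ler_pdivrMr.
have k0 : 0 <= k%:R :> R by [].
have k64 : 64 <= k%:R :> R by nra.
have hkk : (1 - delta / 4) * k%:R <= (1 - delta / 8) * k%:R - 4 by lra.
split; first split => //.
- by rewrite el ler_pdivlMr ?mulr_gt0// CE mulrAC ler_pdivrMr//; nra.
- rewrite el (_ : 2 * d%:R * (H / (16 * d%:R)) = H / 8); last by field;
    exact: lt0r_neq0.
  lra.
- apply: (@le_trans _ _ (l * ((1 - delta / 4) * k%:R)));
    last by rewrite ler_wpM2l.
  apply: (@le_trans _ _ ((L - ln (32 * d%:R)) * ((1 - delta / 4) * k%:R)));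
      last first.
    by rewrite ler_wpM2r// mulr_ge0//; lra.
  rewrite ct; apply: (@le_trans _ _ (((1 - delta) * L + 2 * d%:R + 1) * k%:R)).
    have -> : ((1 - delta) * L + 2 * d%:R + 1) * k%:R =
      (1 - delta) * L * k%:R + 2 * k%:R * d%:R + k%:R by ring.
    by rewrite lerD2l; lra.
  rewrite mulrA ler_wpM2r//.
  have : 0 <= delta / 4 * ln (32 * d%:R) by rewrite mulr_ge0// divr_ge0// ltW.
  have : 0 <= L * delta by rewrite mulr_ge0// ltW.
  lra.
have lK : l <= K * s.
  apply: (@le_trans _ _ (expR l)).
    by have := expR_ge1Dx l; lra.
  rewrite el; apply: le_trans HK; rewrite ler_pdivrMr ?mulr_gt0//.
  by rewrite ler_peMr ?ltW//; lra.
have -> : 2 * C = expR (ln (2 * C)) by rewrite lnK// posrE; lra.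
rewrite -!expRD ler_expR.
have : l * ((1 - delta / 8) * k%:R + 2) <= K * s * (k%:R + 2).
  rewrite ler_pM//; last by nra.
  by rewrite addr_ge0// mulr_ge0//; lra.
have : ln (2 * C) <= ln (2 * C) * s by rewrite ler_peMr// ln_ge0//; lra.
lra.
Qed.

Lemma lower_regime (R : realType) (d : nat) (x delta K L s t a H : R) :
  (0 < d)%N -> 0 < delta <= 2^-1 -> K = `|x| + 3 * d%:R ->
  s = expR L -> t = expR s -> a = x + d%:R * s - d%:R * ln L ->
  H = a + 2 * d%:R - 2 * delta -> 20 <= L -> `|x| <= L -> 4 / delta <= L ->
  [/\ 10 * L <= s, L <= s, 1 <= s, 1 <= t & L / t <= delta] /\
  [/\ d%:R * (s - L) - `|x| <= H, s / 2 <= H, H <= K * s & 2 / delta <= H].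
Proof.
move=> d_gt0 /andP[dl0 dl1] KE sE tE aE HE L20 Lx L4.
have d1 : 1 <= d%:R :> R by rewrite ler1n.
have sL : 10 * L <= s by rewrite sE; apply: expR_ge_mul; lra.
have Ls : L <= s by lra.
have s1 : 1 <= s by lra.
have tL : L * s <= t by rewrite tE; apply: expR_ge_mul; lra.
have t1 : 1 <= t by have := expR_ge1Dx s; rewrite -tE; lra.
have t0 : 0 < t by lra.
have lnL : ln L <= L by rewrite ltW// ln_sublinear//; lra.
have lnL0 : 0 <= ln L by rewrite ln_ge0//; lra.
have := ler_norm x; have := ler_norm (- x); rewrite normrN => nx1 nx2.
have HdL : d%:R * (s - L) - `|x| <= H.
  have : d%:R * ln L <= d%:R * L by rewrite ler_wpM2l//; lra.
  by rewrite HE aE; lra.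
have sH : s / 2 <= H.
  apply: le_trans HdL; have : s - L <= d%:R * (s - L) by rewrite ler_peMl//; lra.
  lra.
split; split => //.
- rewrite ler_pdivrMr//; apply: (@le_trans _ _ (delta * (L * s)));
    last by rewrite ler_pM2l.
  have dL : 4 <= L * delta by rewrite -ler_pdivrMr.
  by rewrite mulrA [delta * L]mulrC (le_trans Ls)// ler_peMl//; lra.
- have q1 : `|x| <= `|x| * s by rewrite ler_peMr.
  have q2 : 2 * d%:R <= 2 * d%:R * s by rewrite ler_peMr//; lra.
  have q3 : 0 <= d%:R * ln L by rewrite mulr_ge0//; lra.
  by rewrite HE aE KE; lra.
- apply: le_trans sH; have -> : 2 / delta = 4 / delta / 2 by field;
    rewrite lt0r_neq0.
  by rewrite ler_pM2r//; lra.
Qed.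

Section asymptotics.
Variables (R : realType) (d : nat) (disp : measure_display).
Variables (T : measurableType disp) (P : probability T R).
Variable xi : lattice d -> {RV P >-> R}.
Hypothesis d_gt0 : (0 < d)%N.
Hypothesis xi_indep : mutually_independent xi.
Hypothesis xi_exp : forall (z : lattice d) (x : R), 0 <= x ->
  P [set w | xi z w > x] = (expR (- x))%:E.
Variable u : R -> lattice d -> {RV P >-> R}.
Hypothesis u_sol : {ae P, forall w : T,
  unique_nonneg_pam_solution (fun z => xi z w) (fun t z => u t z w)}.

Lemma prob_growth_upper (x delta : R) : 0 < delta < 1 ->
  \forall L \near +oo,
  (P (growth_event u (expR (expR L)) (x + d%:R * expR L - d%:R * ln L)) <=
   (expR (- (expR (- x - 2 * d%:R - delta) *
      (2 * (1 - delta) / (1 + delta)) ^+ d)))%:E)%E.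
Proof.
move=> dl; have := upper_near x d_gt0 dl; apply: filterS => L.
set s := expR L; set t := expR s; set a := x + _ - _.
move=> [[t1 L0 h2 dt lny] hsum].
have t0 : 0 < t by exact: expR_gt0.
have /andP[dl0 dl1] := dl.
have c0 : 0 <= (1 + delta) * L / t by rewrite divr_ge0 ?mulr_ge0//; lra.
pose y (z : lattice d) := a + 2 * d%:R + delta + (1 + delta) * L / t * (norm1
    z)%:R.
have d0 : 0 <= d%:R :> R by [].
have h0 : 0 <= a + 2 * d%:R + delta by apply: le_trans h2;
    rewrite mulr_ge0 ?addr_ge0.
have y0 z : 0 <= y z by rewrite /y addr_ge0// mulr_ge0.
have nt (z : lattice d) : z \in box d (Num.truncn t) -> (norm1 z)%:R <= d%:R * t.
  move=> /box_norm1 zN; apply: (@le_trans _ _ (d * Num.truncn t)%:R).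
    by rewrite ler_nat.
  by rewrite natrM ler_wpM2l// truncn_le// ltW.
apply: (le_trans (prob_growth_le xi_indep xi_exp u_sol t0 y0 _)).
  move=> z v zN yv.
  by apply: (upper_site_cond d_gt0 dl t1 (nt z zN) h2 (erefl _) L0 (lny _ (nt z
      zN)) dt yv).
rewrite lee_fin.
apply: (le_trans (prod_one_minus_le _ _)).
  by move=> z; rewrite -[leRHS]expR0 ler_expR oppr_le0.
rewrite ler_expR lerN2; apply: (le_trans hsum).
rewrite mulr_sumr; apply: ler_sum => z _.
by rewrite -expRD ler_expR /y [leRHS]opprD lexx.
Qed.

Lemma prob_growth_lower (x delta eta : R) : 0 < delta <= 2^-1 -> 0 < eta ->
  \forall L \near +oo,
  ((expR (- (expR (- x - 2 * d%:R + 2 * delta) *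
           (2 * (1 + delta) / (1 - delta)) ^+ d * (1 + delta))) - 2 * eta)%:E <=
   P (growth_event u (expR (expR L)) (x + d%:R * expR L - d%:R * ln L)))%E.
Proof.
move=> dl eta0; have /andP[dl0 dl1] := dl.
have d1 : 1 <= d%:R :> R by rewrite ler1n.
(* Both serve [theta = delta / 8]: [m] gives [theta m >= 1], and [k] makes the loss of 4 per level
   at most [theta k]. *)
pose m := (Num.truncn (8 / delta)).+1.
pose k := (Num.truncn (32 / delta)).+1.
have hm : 8 / delta <= m%:R by apply/ltW; rewrite truncnS_gt.
have hk : 32 / delta <= k%:R by apply/ltW; rewrite truncnS_gt.
have k_gt0 : (0 < k)%N by [].
clearbody m k.
have [C CE] : exists C, C = 4 * d%:R / delta by eexists.
have [K KE] : exists K, K = `|x| + 3 * d%:R by eexists.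
have K0 : 0 <= K by rewrite KE addr_ge0// mulr_ge0.
pose M := (2 * (2 * m + 1) + 1)%N.
have th : 0 <= delta / 8 <= 1 by apply/andP; split; lra.
have thm : 1 <= delta / 8 * m%:R by move: hm; rewrite ler_pdivrMr// => hm; lra.
have Ceps : 4 * d%:R <= delta * C by rewrite CE [delta * _]mulrC divfK//
    lt0r_neq0.
have dl3 : 0 < 1 - delta by lra.
near=> L.
have [s sE] : exists s, s = expR L by eexists.
have [t tE] : exists t, t = expR s by eexists.
have [a aE] : exists a, a = x + d%:R * s - d%:R * ln L by eexists.
have [H HE] : exists H, H = a + 2 * d%:R - 2 * delta by eexists.
have [c cE] : exists c, c = (1 - delta) * L / t by eexists.
rewrite -sE -tE -aE.
have L20 : 20 <= L by near: L; apply: nbhs_pinfty_ge; exact: num_real.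
have Lx : `|x| <= L by near: L; apply: nbhs_pinfty_ge; exact: num_real.
have L4 : 4 / delta <= L by near: L; apply: nbhs_pinfty_ge; exact: num_real.
have [[sL Ls s1 t1 Lt] [HdL sH HK H2]] :=
  lower_regime d_gt0 dl KE sE tE aE HE L20 Lx L4.
have L1 : 4 * (d%:R + 1) <= L / 2.
  by rewrite ler_pdivlMr//; near: L; apply: nbhs_pinfty_ge; exact: num_real.
have s2 : 9 ^+ d / eta <= s.
  by apply: le_trans Ls; near: L; apply: nbhs_pinfty_ge; exact: num_real.
have s3 : 4 * ((5 * M%:R) ^+ d * expR (3 / 2 * `|x|)) / eta <= s.
  by apply: le_trans Ls; near: L; apply: nbhs_pinfty_ge; exact: num_real.
have s5 : 128 * d%:R * d%:R / delta <= s.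
  by apply: le_trans Ls; near: L; apply: nbhs_pinfty_ge; exact: num_real.
have L6 : 2 * (ln (32 * d%:R) + 2 * d%:R + 1) / delta <= L.
  by near: L; apply: nbhs_pinfty_ge; exact: num_real.
have s7 : 2 * ((ln (2 * C) + (k%:R + 2) * K) / delta) <= s.
  by apply: le_trans Ls; near: L; apply: nbhs_pinfty_ge; exact: num_real.
have L0 : 0 < L by exact: lt_le_trans L20.
have s0 : 0 < s by exact: lt_le_trans s1.
have t0 : 0 < t by exact: lt_le_trans t1.
have H0 : 0 < H by apply: lt_le_trans sH; rewrite divr_gt0.
have hs : (ln (2 * C) + (k%:R + 2) * K) * s <= delta * t.
  by have := expR_ge_mul (ltW s0) s7; rewrite -tE mulrAC ler_pdivrMr// [t *
      _]mulrC.
have c0 : 0 < c by rewrite cE divr_gt0// mulr_gt0.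
have ct : c * t = (1 - delta) * L by rewrite cE divfK ?lt0r_neq0.
have EH : expR (- H) = expR (- x - 2 * d%:R + 2 * delta) * (L / t) ^+ d.
  have -> : L / t = expR (ln L - s) by rewrite expRB lnK ?posrE// -tE.
  by rewrite -expRM_natl -expRD HE aE; congr expR; ring.
have LamH : 0 <= H / 4 <= H.
  by rewrite divr_ge0 ?(ltW H0)//= ler_pdivrMr// ler_peMr ?(ltW H0)// ler1n.
have [[l0 C1 Cl Laml hl] hA] :=
  lower_params d_gt0 dl hk t1 s1 (ltW L0) sE sH HK K0 CE s5 L6 hs ct.
(* Larger than the radius [t] of the other bound, since here the sites outside the box have to be
   controlled and not merely ignored. *)
pose N := (Num.truncn (t * s)).+1.
have Nts : t * s <= N%:R by apply/ltW; rewrite truncnS_gt.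
have Nts2 : N%:R <= t * s + 1.
  by rewrite /N -natr1 lerD2r truncn_le// mulr_ge0// ltW.
have haE : 2 * C * expR (ln (H / (16 * d%:R)) * ((1 - delta / 8) * k%:R + 2)) *
    expR ((H + delta) * t) <= expR (t * (a + 2 * d%:R)).
  by apply: (le_trans hA); rewrite HE subrK.
have main := prob_growth_ge (a := a) (m := m) xi_indep xi_exp u_sol N t0 th thm
  k_gt0 LamH dl0 c0 l0 C1 Cl Ceps Laml hl haE.
have far := far_small dl eta0 tE t1 s1 L1 s2 cE Nts.
have close := close_small d_gt0 eta0 tE sE t1 s1 (ltW L0) sL s3 HdL Nts2.
have prod := product_large N dl t0 L0 Lt H2 cE EH.
rewrite EFinB leeBlDr//.
apply: (@le_trans _ _ (\prod_(z <- box d N) (1 - expR (- (H + c * (norm1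
    z)%:R))))%:E).
  by rewrite lee_fin.
apply: (le_trans main); rewrite -addeA leeD2l// -EFinD lee_fin.
have -> : 2 * eta = eta + eta by ring.
exact: lerD.
Unshelve. all: by end_near.
Qed.

End asymptotics.

Lemma near_ln_ln (R : realType) (Q : R -> Prop) :
  (\forall L \near +oo, Q L) -> \forall t \near +oo, Q (ln (ln t)).
Proof.
move=> [M [_ hM]]; exists (expR (expR M)); split; first exact: num_real.
move=> t Mt; apply: hM.
have t0 : 0 < t by exact: lt_trans (expR_gt0 _) Mt.
have h1 : expR M < ln t by rewrite -[expR M]expRK ltr_ln ?posrE ?expR_gt0.
have h0 : 0 < ln t by exact: lt_trans (expR_gt0 _) h1.
by rewrite -[M]expRK ltr_ln ?posrE ?expR_gt0.
Qed.

Lemma cvg_expR (R : realType) (T : Type) (F : set_system T) (FF : Filter F)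
    (f : T -> R) (a : R) :
  f y @[y --> F] --> a -> expR (f y) @[y --> F] --> expR a.
Proof. by move=> fa; apply: continuous_cvg fa; exact: continuous_expR. Qed.

(** * Letting the slack tend to zero *)

Section limits.
Variables (R : realType) (d : nat) (x : R).

Let target := expR (- (2 ^+ d * expR (- x - 2 * d%:R))).

Lemma cvg_ratio (b c : R) :
  (2 * (1 + b * e) / (1 + c * e)) ^+ d @[e --> 0^'+] --> (2 : R) ^+ d.
Proof.
have id0 : e @[e --> 0^'+] --> (0 : R) by exact: cvg_at_right_filter.
have lin a : 1 + a * e @[e --> 0^'+] --> (1 : R).
  rewrite -[X in _ --> X]addr0 -{2}(mulr0 a).
  by apply: cvgD; [exact: cvg_cst|apply: cvgMl_tmp].
have base : 2 * (1 + b * e) / (1 + c * e) @[e --> 0^'+] --> (2 : R).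
  suff : 2 * (1 + b * e) / (1 + c * e) @[e --> 0^'+] --> (2 * 1 / 1 : R).
    by rewrite divr1 mulr1.
  apply: cvgM; first by apply: cvgMl_tmp; exact: lin.
  by apply: cvgV; [rewrite oner_neq0|exact: lin].
have := @continuous_cvg _ _ _ _ _ _ (fun y : R => y ^+ d) 2 (@exprn_continuous
    R d 2) base.
exact.
Qed.

Lemma cvg_upper_limit :
  expR (- (expR (- x - 2 * d%:R - e) * (2 * (1 - e) / (1 + e)) ^+ d))
    @[e --> 0^'+] --> target.
Proof.
have id0 : e @[e --> 0^'+] --> (0 : R) by exact: cvg_at_right_filter.
apply: cvg_expR.
apply: cvgN; rewrite [X in _ --> X]mulrC; apply: cvgM.
  apply: cvg_expR.
  by rewrite -[X in _ --> X]subr0; apply: cvgB => //; exact: cvg_cst.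
have := cvg_ratio (-1) 1.
by under eq_fun do rewrite mulN1r mul1r.
Qed.

Lemma cvg_lower_limit :
  expR (- (expR (- x - 2 * d%:R + 2 * e) * (2 * (1 + e) / (1 - e)) ^+ d * (1 +
      e)))
    @[e --> 0^'+] --> target.
Proof.
have id0 : e @[e --> 0^'+] --> (0 : R) by exact: cvg_at_right_filter.
apply: cvg_expR.
apply: cvgN; rewrite [X in _ --> X]mulrC -[X in _ --> X]mulr1; apply: cvgM;
    first apply: cvgM.
- apply: cvg_expR.
  rewrite -[X in _ --> X]addr0 -{2}(mulr0 2); apply: cvgD; first exact: cvg_cst.
  exact: cvgMl_tmp.
- have := cvg_ratio 1 (-1).
  by under eq_fun do rewrite mulN1r mul1r.
- by rewrite -[X in _ --> X]addr0; apply: cvgD => //; exact: cvg_cst.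
Qed.

End limits.

Theorem theorem1 (R : realType) (d : nat) (hd : (1 <= d)%N)
  (disp : measure_display) (T : measurableType disp) (P : probability T R)
  (xi : lattice d -> {RV P >-> R})
  (xi_indep : mutually_independent xi)
  (xi_exp : forall (z : lattice d) (x : R), 0 <= x ->
     P [set w | xi z w > x] = (expR (- x))%:E)
  (u : R -> lattice d -> {RV P >-> R})
  (u_sol : {ae P, forall w : T,
     unique_nonneg_pam_solution (fun z => xi z w) (fun t z => u t z w)})
  (disp' : measure_display) (T' : measurableType disp') (Q : probability T' R)
  (X : {RV Q >-> R})
  (X_gumbel : forall x : R,
     Q [set w | X w <= x] = (expR (- (2 ^+ d * expR (- x - 2 * d%:R))))%:E) :
  cvg_in_distribution P
    (fun t w => growth_rate (fun s z => u s z w) t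
                + (- (d%:R * ln t) + d%:R * ln (ln (ln t)))%:E)%E
    X.
Proof.
move=> x _.
have -> : cdf X x = (expR (- (2 ^+ d * expR (- x - 2 * d%:R))))%:E.
  by rewrite -X_gumbel /cdf /distribution /pushforward; congr (Q _).
set target := expR _.
pose ev (t : R) := growth_event u t (x + d%:R * ln t - d%:R * ln (ln (ln t))).
have evE t : [set w | (growth_rate (fun s z => u s z w) t +
    (- (d%:R * ln t) + d%:R * ln (ln (ln t)))%:E <= x%:E)%E] = ev t.
  rewrite /ev /growth_event; apply/seteqP; split => w /=;
      rewrite -leeBrDr// -EFinB;
    by rewrite opprD opprK addrA.
under eq_fun do rewrite evE.
have fin t : 0 < t -> P (ev t) \is a fin_num.
  by move=> t0; apply: fin_num_measure; exact: measurable_growth_event.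
apply/fine_cvgP; split.
  by near=> t; apply: fin; near: t; apply: nbhs_pinfty_gt; exact: num_real.
apply/cvgrPdist_le => e e0.
have e40 : 0 < e / 4 by rewrite divr_gt0.
have /cvgrPdist_le /(_ _ e40) hU := cvg_upper_limit (d := d) (x := x).
have /cvgrPdist_le /(_ _ e40) hL := cvg_lower_limit (d := d) (x := x).
(* The slack is fixed before [t] grows. One [del] serves both bounds with error [e / 4]; the lower
   one loses a further [2 * (e / 4)] through the far and close events. *)
have [del [del0 del2 hUd hLd]] : exists del : R, [/\ 0 < del, del <= 2^-1,
  `|target - expR (- (expR (- x - 2 * d%:R - del) * (2 * (1 - del) / (1 + del))
      ^+ d))|
    <= e / 4 &
  `|target - expR (- (expR (- x - 2 * d%:R + 2 * del) *
       (2 * (1 + del) / (1 - del)) ^+ d * (1 + del)))| <= e / 4].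
  near (0 : R)^'+ => del; exists del; split; near: del => //.
  - exact: nbhs_right_gt.
  - by apply: nbhs_right_le; rewrite invr_gt0.
have dl1 : 0 < del < 1 by apply/andP; split => //; lra.
have dl2 : 0 < del <= 2^-1 by apply/andP.
have nU := near_ln_ln (prob_growth_upper hd xi_indep xi_exp u_sol x dl1).
have nL := near_ln_ln (prob_growth_lower hd xi_indep xi_exp u_sol x dl2 e40).
(* Beyond [exp 1] both [t] and [ln t] are positive, so exponentials undo the logarithms in
   [L = ln (ln t)]. *)
have nt : \forall t \near +oo, expR (1 : R) < t by apply: nbhs_pinfty_gt;
    exact: num_real.
apply: filterS3 nt nU nL => t te hu hl.
have t0 : 0 < t by exact: lt_trans (expR_gt0 1) te.
have lnt : 0 < ln t by rewrite ln_gt0// (lt_trans _ te)// expR_gt1.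
move: hu hl; rewrite !lnK ?posrE// -/(ev t) -(fineK (fin t t0)) !lee_fin /=.
move: hUd hLd; rewrite !ler_norml => /andP[a1 a2] /andP[b1 b2] hu hl.
by apply/andP; split; lra.
Unshelve. all: by end_near.
Qed.
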